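(* Let $w\in C(\mathbb{C};\mathbb{C})$ be bounded and nowhere real differentiable, and define $\varrho(z)=\sin(z)+w(z)\exp(-z)$ for $z\in\mathbb{C}$. Then $\varrho$ is nowhere real differentiable, and for all $n,m\in\mathbb{N}$ the set $\mathcal{NN}^\varrho_{n,m,n+m+1}$ is universal.
   Context: For $\varrho:\mathbb{C}\to\mathbb{C}$ and $n,m,W\in\mathbb{N}$, $\mathcal{NN}^\varrho_{n,m,W}$ denotes the set of all functions $\mathbb{C}^n\to\mathbb{C}^m$ of the form $V_L\circ\varrho^{\times W}\circ V_{L-1}\circ\cdots\circ\varrho^{\times W}\circ V_1$ with arbitrary depth $L\ge 2$, where $V_1:\mathbb{C}^n\to\mathbb{C}^W$, $V_2,\dots,V_{L-1}:\mathbb{C}^W\to\mathbb{C}^W$, $V_L:\mathbb{C}^W\to\mathbb{C}^m$ are $\mathbb{C}$-affine maps ($z\mapsto Az+b$ with complex $A,b$) and $\varrho^{\times W}$ applies $\varrho$ componentwise. A class $\mathcal{F}\subseteq C(\mathbb{C}^n;\mathbb{C}^m)$ is universal if for every $g\in C(\mathbb{C}^n;\mathbb{C}^m)$, compact $K\subseteq\mathbb{C}^n$ and $\varepsilon>0$ there is $f\in\mathcal{F}$ with $\sup_{z\in K}\|f(z)-g(z)\|<\varepsilon$. Real differentiability at $z_0$: partial derivatives $\partial_x\varrho(z_0),\partial_y\varrho(z_0)$ exist and $\lim_{h\to0}\frac{\varrho(z_0+h)-\varrho(z_0)-\partial_x\varrho(z_0)\mathrm{Re}(h)-\partial_y\varrho(z_0)\mathrm{Im}(h)}{h}=0$.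 *)

(* Defs.v *)
From HB Require Import structures.
From mathcomp Require Import all_boot all_order all_algebra.
From mathcomp Require Import all_classical all_reals.
From mathcomp Require Import all_analysis.
From mathcomp.real_closed Require Import complex.
Set Implicit Arguments. Unset Strict Implicit. Unset Printing Implicit Defensive.
Import Order.TTheory GRing.Theory Num.Theory.
Import numFieldNormedType.Exports.
Local Open Scope classical_set_scope.
Local Open Scope ring_scope.
Local Open Scope complex_scope.

HB.instance Definition _ (R : rcfType) := NormedModule.copy (complex R) (complex R)^o.

Section Defs.
Variable R : realType.
Local Notation C := R[i].

Definition cexp (z : C) : C :=
  (expR (complex.Re z))%:C * (cos (complex.Im z) +i* sin (complex.Im z)).

Definition csin (z : C) : C := (cexp ('i * z) - cexp (- ('i * z))) / (2 * 'i).

Definition has_partial_x (f : C -> C) (z0 : C) (d : C) : Prop :=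
  (fun t : R => (t^-1)%:C * (f (z0 + t%:C) - f z0)) @ 0^' --> d.
Definition has_partial_y (f : C -> C) (z0 : C) (d : C) : Prop :=
  (fun t : R => (t^-1)%:C * (f (z0 + 'i * t%:C) - f z0)) @ 0^' --> d.

Definition real_differentiable_at (f : C -> C) (z0 : C) : Prop :=
  exists dx dy : C, has_partial_x f z0 dx /\ has_partial_y f z0 dy /\
    (fun h : C => (f (z0 + h) - f z0 - dx * (complex.Re h)%:C
                    - dy * (complex.Im h)%:C) / h) @ 0^' --> 0.

Definition nowhere_real_differentiable (f : C -> C) : Prop :=
  forall z0 : C, ~ real_differentiable_at f z0.

Definition bounded_cfun (f : C -> C) : Prop :=
  exists M : R, forall z : C, `|f z| <= M%:C.

Definition act (rho : C -> C) (W : nat) (v : 'cV[C]_W) : 'cV[C]_W := map_mx rho v.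

(* k hidden W -> W affine layers, each preceded by the activation:
   hidden k x = V_{k+1} (rho (... V_2 (rho x))) with V_{j+2} = (As j, bs j) *)
Fixpoint hidden (rho : C -> C) (W : nat) (As : nat -> 'M[C]_W) (bs : nat -> 'cV[C]_W)
  (k : nat) (x : 'cV[C]_W) : 'cV[C]_W :=
  match k with
  | 0 => x
  | k'.+1 => As k' *m act rho (hidden rho As bs k' x) + bs k'
  end.

(* NN^rho_{n,m,W}: networks V_L o rho o V_{L-1} o ... o rho o V_1, depth L = k + 2 >= 2 *)
Definition NN (rho : C -> C) (n m W : nat) : set ('cV[C]_n -> 'cV[C]_m) :=
  [set f | exists (k : nat) (A1 : 'M[C]_(W, n)) (b1 : 'cV[C]_W)
             (As : nat -> 'M[C]_W) (bs : nat -> 'cV[C]_W)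
             (AL : 'M[C]_(m, W)) (bL : 'cV[C]_m),
     f = fun z => AL *m act rho (hidden rho As bs k (A1 *m z + b1)) + bL].

(* universality (sup norm on C^m: max of complex moduli of the entries) *)
Definition universal (n m : nat) (F : set ('cV[C]_n -> 'cV[C]_m)) : Prop :=
  forall g : 'cV[C]_n -> 'cV[C]_m, continuous g ->
  forall K : set 'cV[C]_n, compact K ->
  forall eps : R, 0 < eps ->
  exists f, F f /\ exists d : R, d < eps /\
    forall z, K z -> `|f z - g z| <= d%:C.

End Defs.
Arguments universal {R} n m F.
Arguments NN {R} rho n m W _.

(* Main.v *)
Require Import Defs.
From HB Require Import structures.
From mathcomp Require Import all_boot all_order all_algebra.
From mathcomp Require Import all_classical all_reals.
From mathcomp Require Import all_analysis.
From mathcomp.real_closed Require Import complex.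
From mathcomp Require Import ring lra.
Set Implicit Arguments.
Unset Strict Implicit.
Unset Printing Implicit Defensive.
Import Order.TTheory GRing.Theory Num.Theory.
Import numFieldNormedType.Exports.
Local Open Scope classical_set_scope.
Local Open Scope ring_scope.
Local Open Scope complex_scope.

(** Since [w] is bounded, [2i e^{-T} rho(-iz - iT)] tends to [exp z] locally
    uniformly as [T] grows, so a single neuron approximates [exp], hence also
    the identity.  With [n] registers holding the input, [m] accumulating the
    output and one scratch register, networks of width [n + m + 1] approximate
    every sum of functions computed in the scratch register by a chain of
    neurons with access to the input.

    The key point is that complex conjugation is a locally uniform limit of
    combinations of [x |-> rho (exp (a x + b))], [x] and [1].  For an integer
    [mu], average [Q x = e^{-mu x} rho(e^x)] over the [N]-th roots of unity;
    in the limit only the dependence on [Re x] remains.  If for some [mu] this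
    limit is not constant, a telescoping Riemann sum of its translates is
    differentiable with nonzero antiholomorphic part, and zooming in gives
    [Re x].  Otherwise the Fourier coefficients of [rho] on circles around [0]
    are [c_mu r^mu], vanishing for [mu < 0], and Fejer summation gives
    [rho z = rho 0 + c z + O(z^2)], contradicting non-differentiability at [0].
    Only finite averages occur, no integrals.

    It follows that [exp(b.z) * conj(exp(a.z))] is approximable for all [a] and
    [b].  These functions span an algebra containing, in the limit, all real
    coordinates, and the Bernstein form of the Weierstrass theorem concludes. *)

(** * Modulus and exponential *)

(** One scratch register cannot hold two intermediate results, and this shapes the whole argument:
    sums can be formed only in the output registers, and two computed functions cannot be multiplied
    directly. The approximable scalar functions are thus seen at once to form a closed linear space,
    but not an algebra. Products come from two devices. A difference quotient in h of exp(h s + b.z)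
    multiplies a computed s by exp(b.z), because the input is still at hand. And the functions
    exp(b.z) * conj(exp(a.z)) are stable under products because exponents add, so their closed span
    is an algebra without any further network. Composing [rho] with exp turns rotations of its
    argument into imaginary translations, which biases can realise. An average over N of them has
    period 2 pi i / N, and uniform continuity then makes it nearly independent of Im x. Convergence
    as N grows is never established: the alternative is whether the difference of the averages at
    two real points stays bounded below for arbitrarily large N, and the Taylor coefficients found
    in the other case may still vary with N. *)

Section Modulus.
Variable R : realType.
Local Notation C := R[i].

Definition modc (z : C) : R := ComplexField.Normc.normc z.

Lemma norm_modc (z : C) : `|z| = (modc z)%:C. Proof. by []. Qed.

Lemma ReD (x y : C) : complex.Re (x + y) = complex.Re x + complex.Re y.
Proof. by case: x; case: y. Qed.

Lemma modc_ge0 z : 0 <= modc z.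
Proof. by case: z => a b; exact: sqrtr_ge0. Qed.

Lemma modcM x y : modc (x * y) = modc x * modc y.
Proof. exact: ComplexField.Normc.normcM. Qed.

Lemma modcD x y : modc (x + y) <= modc x + modc y.
Proof. exact: le_normcD. Qed.

Lemma modcN x : modc (- x) = modc x.
Proof. exact: normcN. Qed.

Lemma modcB x y : modc (x - y) <= modc x + modc y.
Proof. by rewrite (le_trans (modcD _ _))// modcN. Qed.

Lemma modc_sym x y : modc (x - y) = modc (y - x).
Proof. by rewrite -modcN opprB. Qed.

Lemma modc_trans y x z : modc (x - z) <= modc (x - y) + modc (y - z).
Proof. by rewrite -[x - z](subrKA y) modcD. Qed.

Lemma modc_le_add x y : modc x <= modc y + modc (x - y).
Proof. by rewrite -{1}(subrKC y x) modcD. Qed.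

Lemma modc0 : modc 0 = 0.
Proof. exact: ComplexField.Normc.normc0. Qed.

Lemma modc1 : modc 1 = 1.
Proof. exact: ComplexField.Normc.normc1. Qed.

Lemma modc_eq0 z : modc z = 0 -> z = 0.
Proof. exact: ComplexField.Normc.eq0_normc. Qed.

Lemma modc_gt0 z : z != 0 -> 0 < modc z.
Proof.
move=> z0; rewrite lt_neqAle modc_ge0 andbT eq_sym.
by apply: contra z0 => /eqP/modc_eq0 ->.
Qed.

Lemma modcV z : modc z^-1 = (modc z)^-1.
Proof. exact: ComplexField.Normc.normcV. Qed.

Lemma modcX z n : modc (z ^+ n) = modc z ^+ n.
Proof.
by elim: n => [|n IH]; rewrite ?expr0 ?modc1// !exprS modcM IH.
Qed.

Lemma modcR (x : R) : modc x%:C = `|x|.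
Proof. by rewrite /modc/= expr0n/= addr0 sqrtr_sqr. Qed.

Lemma modc_nat n : modc n%:R = n%:R.
Proof.
have -> : (n%:R : C) = (n%:R : R)%:C by rewrite rmorph_nat.
by rewrite modcR ger0_norm.
Qed.

Lemma modci : modc 'i = 1.
Proof. by rewrite /modc/= expr0n/= add0r expr1n sqrtr1. Qed.

Lemma modc_Re z : `|complex.Re z| <= modc z.
Proof.
case: z => a b; rewrite /modc/= -sqrtr_sqr ler_wsqrtr//.
by rewrite lerDl sqr_ge0.
Qed.

Lemma modc_Im z : `|complex.Im z| <= modc z.
Proof.
case: z => a b; rewrite /modc/= -sqrtr_sqr ler_wsqrtr//.
by rewrite lerDr sqr_ge0.
Qed.

Lemma modc_ReIm z : modc z <= `|complex.Re z| + `|complex.Im z|.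
Proof.
rewrite {1}(complexE z) (le_trans (modcD _ _))//.
by rewrite modcM !modcR modci mul1r.
Qed.

Lemma modc_conj z : modc z^* = modc z.
Proof. by case: z => a b; rewrite /modc/= sqrrN. Qed.

Lemma modc_sqr z : (modc z ^+ 2)%:C = z * z^*.
Proof. by rewrite rmorphXn/= -sqr_normc. Qed.

Lemma modc_sum (I : Type) (r : seq I) (P : pred I) (F : I -> C) :
  modc (\sum_(i <- r | P i) F i) <= \sum_(i <- r | P i) modc (F i).
Proof.
elim/big_ind2 : _ => [|x a y b xa yb|//]; first by rewrite modc0.
by rewrite (le_trans (modcD _ _))// lerD.
Qed.

Lemma modc_sum_le (I : finType) (F : I -> C) (e : R) :
  (forall i, modc (F i) <= e) -> modc (\sum_i F i) <= #|I|%:R * e.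
Proof.
move=> Fe; rewrite (le_trans (modc_sum _ _ _))//.
rewrite (le_trans (ler_sum _ (fun i _ => Fe i)))//.
by rewrite sumr_const mulr_natl.
Qed.

Lemma modc_lincomb (I : finType) (p : I -> R) (F : I -> C) (c : C) :
  (forall i, 0 <= p i) -> \sum_i p i = 1 ->
  modc (\sum_i (p i)%:C * F i - c) <= \sum_i p i * modc (F i - c).
Proof.
move=> p0 p1.
have -> : \sum_i (p i)%:C * F i - c = \sum_i (p i)%:C * (F i - c).
  under [RHS]eq_bigr do rewrite mulrBr.
  by rewrite sumrB -mulr_suml -rmorph_sum/= p1 mul1r.
rewrite (le_trans (modc_sum _ _ _))// ler_sum// => i _.
by rewrite modcM modcR ger0_norm.
Qed.

End Modulus.
Arguments modc : simpl never.

Arguments cexp : simpl never.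

(** * The complex exponential: functional equation, surjectivity, derivative at 0 *)

Section ComplexExponential.
Variable R : realType.
Local Notation C := R[i].
Implicit Types z : C.

Lemma cexpD z1 z2 : cexp (z1 + z2) = cexp z1 * cexp z2.
Proof.
case: z1 => a b; case: z2 => c d; rewrite /cexp/= expRD cosD sinD.
apply/eqP; rewrite eq_complex/=; apply/andP; split; apply/eqP; ring.
Qed.

Lemma cexp0 : cexp 0 = 1 :> C.
Proof. by rewrite /cexp/= expR0 cos0 sin0 mul1r. Qed.

Lemma modc_cexp z : modc (cexp z) = expR (complex.Re z).
Proof.
rewrite /cexp modcM modcR ger0_norm ?expR_ge0//.
by rewrite /modc/= cos2Dsin2 sqrtr1 mulr1.
Qed.

Lemma cexp_neq0 z : cexp z != 0.
Proof.
apply/eqP => z0; have := modc_cexp z; rewrite z0 modc0 => /eqP.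
by rewrite eq_sym expR_eq0.
Qed.

Lemma cexpN z : cexp (- z) = (cexp z)^-1.
Proof.
apply: (mulfI (cexp_neq0 z)); rewrite -cexpD subrr cexp0 divff//.
exact: cexp_neq0.
Qed.

Lemma cexpB z1 z2 : cexp (z1 - z2) = cexp z1 / cexp z2.
Proof. by rewrite cexpD cexpN. Qed.

Lemma cexp_natM n z : cexp (n%:R * z) = cexp z ^+ n.
Proof.
elim: n => [|n IH]; first by rewrite mul0r cexp0 expr0.
by rewrite -natr1 mulrDl mul1r cexpD IH exprSr.
Qed.

Lemma cexp_real (x : R) : cexp x%:C = (expR x)%:C.
Proof. by rewrite /cexp/= cos0 sin0 mulr1. Qed.

Lemma cexp_2pi z : cexp (z + 'i * (pi *+ 2)%:C) = cexp z.
Proof.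
rewrite cexpD [X in _ * X](_ : _ = 1) ?mulr1//.
rewrite /cexp/=; apply/eqP; rewrite eq_complex/=.
by rewrite !(mul0r, mul1r, mulr0, subr0, add0r, addr0) oppr0 cos2pi sin2pi expR0 mul1r mulr0 !eqxx.
Qed.

Lemma cexp_conj z : (cexp z)^* = cexp z^*.
Proof.
case: z => a b; rewrite /cexp/= cosN sinN.
by apply/eqP; rewrite eq_complex/= ; apply/andP; split; apply/eqP; ring.
Qed.

Lemma cexp_surj z : z != 0 -> exists y, cexp y = z.
Proof.
move=> z0; have m0 := modc_gt0 z0.
case: z z0 m0 => a b z0; set m := modc _ => m0.
have mn : m != 0 by rewrite gt_eqF.
have m2 : m ^+ 2 = a ^+ 2 + b ^+ 2.
  by rewrite /m /modc/= sqr_sqrtr// addr_ge0// sqr_ge0.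
have ab : (a / m) ^+ 2 + (b / m) ^+ 2 = 1.
  by rewrite !expr_div_n -mulrDl -m2 divff// expf_neq0// gt_eqF.
have am : -1 <= a / m <= 1.
  rewrite -ler_norml -sqrtr_sqr -sqrtr1 ler_wsqrtr// -ab lerDl sqr_ge0//.
(* [acos] takes values in [0, pi]: it is the argument on the closed upper half plane, and minus the
   argument below. *)
have [b0|b0] := leP 0 b.
  exists (ln m +i* acos (a / m)); rewrite /cexp/= lnK ?posrE//.
  rewrite acosK ?in_itv//= sin_acos// -ab addrC addKr sqrtr_sqr ger0_norm ?mulr_ge0 ?invr_ge0 ?(ltW m0)//.
  apply/eqP; rewrite eq_complex/= !mul0r subr0 addr0.
  by rewrite ![m * _]mulrC !divfK// !eqxx.
exists (ln m +i* - acos (a / m)); rewrite /cexp/= lnK ?posrE//.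
rewrite cosN sinN acosK ?in_itv//= sin_acos// -ab addrC addKr sqrtr_sqr ler0_norm; last first.
  by rewrite pmulr_lle0 ?invr_gt0// ltW.
apply/eqP; rewrite eq_complex/= !mul0r subr0 addr0 opprK.
by rewrite ![m * _]mulrC !divfK// !eqxx.
Qed.

Lemma is_derive_eps (f : R -> R) (x0 d : R) : is_derive x0 (1 : R) f d ->
  forall e, 0 < e -> exists2 dl, 0 < dl &
    forall h, `|h| <= dl -> `|f (x0 + h) - f x0 - d * h| <= e * `|h|.
Proof.
move=> [df dE] e e0.
have := df; rewrite /derivable => /cvgrPdist_le /(_ e e0).
rewrite -/(derive f x0 1) dE.
move=> /nbhs_ballP [dl /= dl0 H]; exists (dl / 2); first by rewrite divr_gt0.
move=> h hd; have [->|h0] := eqVneq h 0.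
  by rewrite addr0 subrr mulr0 subr0 normr0 mulr0.
have := H h; rewrite /ball/= /ball_/= sub0r normrN.
have hdl : `|h| < dl by rewrite (le_lt_trans hd)// ltr_pdivrMr// ltr_pMr// ltr1n.
move=> /(_ hdl h0).
rewrite /= /GRing.scale/= mulr1 => H1.
rewrite -ler_pdivrMr ?normr_gt0// -normfV -normrM.
rewrite [leLHS](_ : _ = `|d - h^-1 * (f (h + x0) - f x0)|)// -normrN.
congr (`|_|); rewrite addrC (addrC x0); by field.
Qed.

Lemma cexp_diff0 (e : R) : 0 < e -> exists2 d, 0 < d &
  forall z, modc z <= d -> modc (cexp z - 1 - z) <= e * modc z.
Proof.
move=> e0; pose e' := Num.min (e / 8) 1.
have e'0 : 0 < e' by rewrite lt_min divr_gt0//=.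
have [e'e e'1] : e' <= e / 8 /\ e' <= 1 by rewrite /e' !ge_min !lexx orbT.
have [d1 d10 H1] := @is_derive_eps expR 0 _ (is_derive_expR 0) _ e'0.
have [d2 d20 H2] := @is_derive_eps sin 0 _ (is_derive_sin 0) _ e'0.
have [d3 d30 H3] := @is_derive_eps cos 0 _ (is_derive_cos 0) _ e'0.
exists (Num.min (Num.min d1 d2) (Num.min d3 (e' / 2))).
  by rewrite !lt_min d10 d20 d30 divr_gt0.
move=> z; rewrite !le_min => /andP[/andP[z1 z2] /andP[z3 z4]].
have Rz := modc_Re z; have Iz := modc_Im z.
case: z z1 z2 z3 z4 Rz Iz => x y; set m := modc _ => z1 z2 z3 z4 /= Rz Iz.
have := H1 x (le_trans Rz z1); rewrite !add0r expR0 mul1r => {}H1.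
have := H2 y (le_trans Iz z2); rewrite !add0r sin0 cos0 mul1r subr0 => {}H2.
have := H3 y (le_trans Iz z3); rewrite !add0r sin0 cos0 oppr0 mul0r subr0 => {}H3.
have ex1 : `|expR x - 1| <= e'.
  have := ler_normD (expR x - 1 - x) x; rewrite subrK => h.
  have : e' * `|x| <= 1 * (e' / 2) by apply: ler_pM => //; [exact: ltW | exact: le_trans Rz z4].
  lra.
have ex2 : expR x <= 2.
  have := ler_norm (expR x - 1); lra.
(* The summands isolate the errors of cos and sin, the error of the real exponential, and the cross
   term. Together they are at most 6 e' |z|, whence the choice e / 8 for e'. *)
rewrite [X in modc X](_ : _ =
    (expR x)%:C * ((cos y - 1) +i* (sin y - y)) + (expR x - 1 - x)%:C +
    ('i * (y * (expR x - 1))%:C)); last first.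
  by rewrite /cexp; apply/eqP; rewrite eq_complex/=; apply/andP; split; apply/eqP; ring.
apply: (@le_trans _ _ (2 * (e' * m + e' * m) + e' * m + m * e')); last first.
  have m0 : 0 <= m := modc_ge0 _.
  have : e' * m <= e / 8 * m by rewrite ler_wpM2r.
  have : 0 <= e * m by rewrite mulr_ge0// ltW.
  lra.
have m0 : 0 <= m := modc_ge0 _.
have em : e' * `|x| <= e' * m by rewrite ler_wpM2l// ltW.
have emy : e' * `|y| <= e' * m by rewrite ler_wpM2l// ltW.
rewrite (le_trans (modcD _ _))// lerD//; last first.
  by rewrite modcM modci mul1r modcR normrM ler_pM.
rewrite (le_trans (modcD _ _))// lerD//; last first.
  by rewrite modcR; apply: le_trans em.
rewrite modcM modcR ger0_norm ?expR_ge0// ler_pM ?expR_ge0 ?modc_ge0//.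
by rewrite (le_trans (modc_ReIm _))//= lerD//; apply: le_trans emy.
Qed.

End ComplexExponential.

(** * Closed spans and uniform continuity *)

Section ClosedSpan.
Variables (R : realType) (T : Type) (D : set T).
Local Notation C := R[i].
Implicit Types (f g : T -> C) (V E : set (T -> C)).

Definition unif_approx V f := forall e : R, 0 < e ->
  exists2 g, V g & forall t, D t -> modc (g t - f t) <= e.

Definition closed_subspace V :=
  [/\ V (fun=> 0), forall f g (c : C), V f -> V g -> V (fun t => f t + c * g t)
    & forall f, unif_approx V f -> V f].

(** Encoded as the intersection of all closed subspaces containing [E], so that membership is an
    induction principle: choose [V], check that it is a closed subspace and that it contains the
    generators. *)
Definition closed_span E : set (T -> C) :=
  [set f | forall V, closed_subspace V -> E `<=` V -> V f].

Lemma closed_span_subspace E : closed_subspace (closed_span E).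
Proof.
split=> [V [V0 _ _] _ //|f g c Ef Eg V HV EV|f fE V HV EV].
  by have [_ VD _] := HV; apply: VD; [exact: Ef|exact: Eg].
have [_ _ Vc] := HV; apply: Vc => e e0.
by have [g Eg gf] := fE e e0; exists g => //; exact: Eg.
Qed.

Lemma sub_closed_span E : E `<=` closed_span E.
Proof. by move=> f Ef V _; exact. Qed.

Section Subspace.
Variable V : set (T -> C).
Hypothesis HV : closed_subspace V.

Lemma subspace_lim f : unif_approx V f -> V f.
Proof. by have [_ _] := HV; exact. Qed.

(** Approximation is tested on [D] only, so a closed subspace does not see values outside [D];
    pointwise rewriting on [D] can replace equality of functions. *)
Lemma subspace_eq f g : (forall t, D t -> f t = g t) -> V f -> V g.
Proof.
move=> fg Vf; apply: subspace_lim => e e0; exists f => // t Dt.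
by rewrite fg// subrr modc0 ltW.
Qed.

Lemma subspace0 : V (fun=> 0). Proof. by have [] := HV. Qed.

Lemma subspaceDZ f g (c : C) : V f -> V g -> V (fun t => f t + c * g t).
Proof. by have [_ + _] := HV; exact. Qed.

Lemma subspaceD f g : V f -> V g -> V (fun t => f t + g t).
Proof.
move=> Vf Vg; apply: (subspace_eq _ (subspaceDZ 1 Vf Vg)) => t _.
by rewrite mul1r.
Qed.

Lemma subspaceZ f (c : C) : V f -> V (fun t => c * f t).
Proof.
move=> Vf; apply: (subspace_eq _ (subspaceDZ c subspace0 Vf)) => t _.
by rewrite add0r.
Qed.

Lemma subspaceB f g : V f -> V g -> V (fun t => f t - g t).
Proof.
move=> Vf Vg; apply: (subspace_eq _ (subspaceDZ (-1) Vf Vg)) => t _.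
by rewrite mulN1r.
Qed.

Lemma subspace_sum (I : Type) (s : seq I) (P : pred I) (F : I -> T -> C) :
  (forall i, P i -> V (F i)) -> V (fun t => \sum_(i <- s | P i) F i t).
Proof.
move=> VF; elim: s => [|i s IH].
  by apply: (subspace_eq _ subspace0) => t _; rewrite big_nil.
have [Pi|/negbTE Pi] := boolP (P i).
  apply: (subspace_eq _ (subspaceD (VF i Pi) IH)) => t _.
  by rewrite big_cons Pi.
by apply: (subspace_eq _ IH) => t _; rewrite big_cons Pi.
Qed.

End Subspace.

Definition bounded_on f := exists r : R, forall t, D t -> modc (f t) <= r.

Lemma bounded_subspace : closed_subspace bounded_on.
Proof.
split=> [|f g c [r fr] [s gs]|f fb].
- by exists 0 => t _; rewrite modc0.
- exists (r + modc c * s) => t Dt.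
  by rewrite (le_trans (modcD _ _))// lerD ?fr// modcM ler_wpM2l ?modc_ge0 ?gs.
- have [g [r gr] gf] := fb 1 ltr01.
  exists (r + 1) => t Dt; rewrite (le_trans (modc_le_add _ (g t)))//.
  by rewrite lerD ?gr// modc_sym gf.
Qed.

Lemma bounded_onM f g : bounded_on f -> bounded_on g ->
  bounded_on (fun t => f t * g t).
Proof.
move=> [r fr] [s gs]; exists (r * s) => t Dt.
by rewrite modcM ler_pM ?modc_ge0// ?fr ?gs.
Qed.

Lemma mul_subspace V f : closed_subspace V -> bounded_on f ->
  closed_subspace [set g | V (fun t => f t * g t)].
Proof.
move=> HV [r fr]; split=> /=.
- by apply: (subspace_eq HV _ (subspace0 HV)) => t _; rewrite mulr0.
- move=> g1 g2 c V1 V2; apply: (subspace_eq HV _ (subspaceDZ HV c V1 V2)) => t _.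
  by rewrite mulrDr mulrCA.
- move=> g gV; apply: (subspace_lim HV) => e e0.
  have r0 : 0 < `|r| + 1 by rewrite ltr_wpDl.
  have [h Vh hg] := gV _ (divr_gt0 e0 r0).
  exists (fun t => f t * h t) => // t Dt.
  rewrite -mulrBr modcM -[e](divfK (lt0r_neq0 r0)) mulrC.
  rewrite ler_pM ?modc_ge0 ?hg//.
  by rewrite (le_trans (fr t Dt))// (le_trans (ler_norm r))// lerDl.
Qed.

Definition mul_closed E :=
  forall f g, E f -> E g -> E (fun t => f t * g t).

(** Two inductions on the span, one per factor: the functions whose product with a fixed bounded
    function lies in a closed subspace form a closed subspace again. Boundedness passes from the
    generators to the span because bounded functions form a closed subspace too. *)
Lemma closed_span_mul E : mul_closed E -> E `<=` bounded_on ->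
  mul_closed (closed_span E).
Proof.
move=> EM Eb.
have HS := closed_span_subspace E.
have EfS f g : E f -> closed_span E g -> closed_span E (fun t => f t * g t).
  move=> Ef Eg; apply: (Eg [set g | closed_span E (fun t => f t * g t)]).
    exact: (mul_subspace HS (Eb _ Ef)).
  by move=> h Eh; apply: sub_closed_span; exact: EM.
move=> f g Sf Sg; apply: (Sg [set g | closed_span E (fun t => f t * g t)]).
  by apply: (mul_subspace HS); apply: Sf => //; exact: bounded_subspace.
move=> h Eh; apply: (subspace_eq HS _ (EfS _ _ Eh Sf)) => t _.
by rewrite mulrC.
Qed.

End ClosedSpan.

(** * Uniform continuity on discs, with explicit moduli *)

Section UniformContinuity.
Variable R : realType.
Local Notation C := R[i].
Implicit Types f g : C -> C.

Definition unif_modulus f (r d e : R) := forall x y : C,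
  modc x <= r -> modc y <= r -> modc (x - y) <= d -> modc (f x - f y) <= e.

(** Uniform continuity on every closed disc. A modulus in this form survives averaging with
    constants that do not depend on the number of terms. *)
Definition ucont f := forall r e : R, 0 < e ->
  exists2 d, 0 < d & unif_modulus f r d e.

Lemma exists_nat_gt (x : R) : exists2 n : nat, (0 < n)%N & x < n%:R.
Proof.
exists (Num.truncn `|x|).+1 => //.
by rewrite (le_lt_trans (ler_norm x))// truncnS_gt.
Qed.

Lemma exists_nat_inv_lt (x d : R) : 0 < d ->
  exists2 n : nat, (0 < n)%N & forall m, (n <= m)%N -> x / m%:R <= d.
Proof.
move=> d0; have [n n0 xn] := exists_nat_gt (x / d).
exists n => // m nm; have m0 : 0 < m%:R :> R by rewrite ltr0n (leq_trans n0).
rewrite ler_pdivrMr// mulrC -ler_pdivrMr// (le_trans (ltW xn))//.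
by rewrite ler_nat.
Qed.

(** The segment from 0 to [x] is cut into [n] steps of length at most [d], each changing [f] by at
    most 1. *)
Lemma ucont_bounded f : ucont f ->
  forall r, exists2 B, 0 <= B & forall x, modc x <= r -> modc (f x) <= B.
Proof.
move=> uf r.
have [d d0 fd] := uf r 1 ltr01.
have [n n0 nr] := exists_nat_inv_lt r d0.
exists (modc (f 0) + n%:R); first by rewrite addr_ge0// modc_ge0.
move=> x xr; have r0 := le_trans (modc_ge0 x) xr.
have n0' : n%:R != 0 :> R by rewrite pnatr_eq0 -lt0n.
suff : forall k, (k <= n)%N ->
    modc (f ((k%:R / n%:R)%:C * x)) <= modc (f 0) + k%:R.
  by move=> /(_ n (leqnn _)); rewrite divff// mul1r.
elim=> [_|k IH kn]; first by rewrite mul0r mul0r addr0.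
have inr j : (j <= n)%N -> modc ((j%:R / n%:R)%:C * x) <= r.
  move=> jn; rewrite modcM modcR ger0_norm ?divr_ge0//.
  rewrite -[leRHS]mul1r ler_pM ?modc_ge0 ?divr_ge0//.
  by rewrite ler_pdivrMr ?ltr0n// mul1r ler_nat.
apply: (le_trans (modc_le_add _ (f ((k%:R / n%:R)%:C * x)))).
rewrite -[in leRHS]natr1 addrA lerD ?IH//; first exact: ltnW.
apply: fd; rewrite ?inr//; first exact: ltnW.
rewrite -mulrBl -rmorphB/= modcM modcR -mulrBl -natr1 addrAC subrr add0r.
rewrite ger0_norm ?divr_ge0// mul1r mulrC (le_trans _ (nr n (leqnn _)))//.
by rewrite ler_wpM2r ?invr_ge0.
Qed.

Lemma ucont_comp f g : ucont f -> ucont g -> ucont (f \o g).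
Proof.
move=> uf ug r e e0.
have [B B0 gB] := ucont_bounded ug r.
have [d d0 fd] := uf B e e0.
have [d' d'0 gd] := ug r d d0.
by exists d' => // x y xr yr xy; apply: fd; [exact: gB|exact: gB|exact: gd].
Qed.

Lemma ucont_mul f g : ucont f -> ucont g -> ucont (fun z => f z * g z).
Proof.
move=> uf ug r e e0.
have [B B0 fB] := ucont_bounded uf r.
have [B' B'0 gB] := ucont_bounded ug r.
have c0 : 0 < B + B' + 1 by rewrite ltr_wpDl// addr_ge0.
have [d d0 fd] := uf r _ (divr_gt0 e0 c0).
have [d' d'0 gd] := ug r _ (divr_gt0 e0 c0).
exists (Num.min d d'); first by rewrite lt_min d0.
move=> x y xr yr; rewrite le_min => /andP[xy xy'].
have -> : f x * g x - f y * g y = (f x - f y) * g x + f y * (g x - g y) by ring.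
rewrite (le_trans (modcD _ _))// !modcM.
have ec0 : 0 <= e / (B + B' + 1) by rewrite divr_ge0// ltW.
apply: (@le_trans _ _ (e / (B + B' + 1) * B' + B * (e / (B + B' + 1)))).
  by rewrite lerD// ler_pM ?modc_ge0 ?fB ?gB ?fd ?gd.
rewrite [B * _]mulrC -mulrDr -[leRHS](divfK (lt0r_neq0 c0)) ler_wpM2l//.
by rewrite [B' + B]addrC lerDl.
Qed.

Lemma ucont_add f g : ucont f -> ucont g -> ucont (fun z => f z + g z).
Proof.
move=> uf ug r e e0; have e20 : 0 < e / 2 by rewrite divr_gt0.
have [d d0 fd] := uf r _ e20.
have [d' d'0 gd] := ug r _ e20.
exists (Num.min d d'); first by rewrite lt_min d0.
move=> x y xr yr; rewrite le_min => /andP[xy xy'].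
have -> : f x + g x - (f y + g y) = (f x - f y) + (g x - g y) by ring.
by rewrite (le_trans (modcD _ _))// [leRHS]splitr lerD ?fd ?gd.
Qed.

Lemma ucont_affine a b : ucont (fun z => a * z + b).
Proof.
move=> r e e0; have c0 : 0 < modc a + 1 by rewrite ltr_wpDl ?modc_ge0.
exists (e / (modc a + 1)); first by rewrite divr_gt0.
move=> x y _ _ xy; rewrite [X in modc X](_ : _ = a * (x - y)) ?modcM; last by ring.
apply: (@le_trans _ _ ((modc a + 1) * (e / (modc a + 1)))); last first.
  by rewrite mulrC divfK// gt_eqF.
by rewrite ler_pM ?modc_ge0// lerDl.
Qed.

Lemma ucont_cexp : ucont (@cexp R).
Proof.
move=> r e e0; have e'0 : 0 < e / (2 * expR r) by rewrite divr_gt0// mulr_gt0// expR_gt0.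
have [d d0 H] := cexp_diff0 (R := R) ltr01.
exists (Num.min d (e / (2 * expR r))); first by rewrite lt_min d0.
move=> x y xr yr; rewrite le_min => /andP[xy xy'].
have -> : cexp x - cexp y = cexp y * (cexp (x - y) - 1).
  by rewrite mulrBr mulr1 -cexpD subrKC.
rewrite modcM modc_cexp.
have h1 : modc (cexp (x - y) - 1) <= 2 * modc (x - y).
  rewrite (le_trans (modc_le_add _ (x - y)))//.
  by have := H _ xy; lra.
apply: (@le_trans _ _ (expR r * (2 * (e / (2 * expR r))))); last first.
  by rewrite mulrCA mulrA mulrC divfK// mulf_neq0// gt_eqF ?expR_gt0.
rewrite ler_pM ?expR_ge0 ?modc_ge0//.
  by rewrite ler_expR (le_trans (ler_norm _))// (le_trans (modc_Re _)).
by rewrite (le_trans h1)// ler_wpM2l.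
Qed.

End UniformContinuity.

(** * Averages over roots of unity *)

Section CircleAverages.
Variable R : realType.
Local Notation C := R[i].
Implicit Types (Q G : C -> C) (N K : nat).

Lemma modc_mean N (F : 'I_N -> C) (e : R) : (0 < N)%N ->
  (forall j, modc (F j) <= e) -> modc (N%:R^-1 * \sum_j F j) <= e.
Proof.
move=> N0 Fe; rewrite modcM modcV modc_nat ler_pdivrMl ?ltr0n//.
by rewrite (le_trans (modc_sum_le Fe))// card_ord.
Qed.

Definition root_arg N (j : nat) : C := 'i * ((pi *+ 2) * (j%:R / N%:R))%:C.

(** In the variable [cexp z] this averages over the rotations by the N-th roots of unity; in
    additive form the rotations are translations. *)
Definition avg N Q (z : C) : C := N%:R^-1 * \sum_(j < N) Q (z + root_arg N j).

(** A crude bound for a full turn, and the origin of the enlarged radius [r + 8] on which [Q] must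
    be controlled to control [avg N Q] on radius [r]. *)
Lemma pi2_lt8 : pi *+ 2 < 8 :> R.
Proof. by have := @pihalf_lt2 R; lra. Qed.

Lemma modc_root_arg N (j : 'I_N) : modc (root_arg N j) <= 8.
Proof.
have N0 : (0 < N)%N by rewrite (leq_trans _ (ltn_ord j)).
rewrite modcM modci mul1r modcR ger0_norm; last first.
  by rewrite mulr_ge0 ?divr_ge0// mulrn_wge0// pi_ge0.
rewrite -[leRHS]mulr1; apply: ler_pM; rewrite ?divr_ge0//.
- by rewrite mulrn_wge0// pi_ge0.
- exact/ltW/pi2_lt8.
- by rewrite ler_pdivrMr ?ltr0n// mul1r ler_nat ltnW.
Qed.

Lemma avg_modulus N Q r d e : (0 < N)%N ->
  unif_modulus Q (r + 8) d e -> unif_modulus (avg N Q) r d e.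
Proof.
move=> N0 Qu x y xr yr xy; rewrite /avg -mulrBr -sumrB.
apply: modc_mean => // j; apply: Qu.
- by rewrite (le_trans (modcD _ _))// lerD// modc_root_arg.
- by rewrite (le_trans (modcD _ _))// lerD// modc_root_arg.
- by rewrite [X in modc X](_ : _ = x - y)//; ring.
Qed.

Lemma avg_bound N Q r B : (0 < N)%N ->
  (forall x, modc x <= r + 8 -> modc (Q x) <= B) ->
  forall x, modc x <= r -> modc (avg N Q x) <= B.
Proof.
move=> N0 QB x xr; apply: modc_mean => // j; apply: QB.
by rewrite (le_trans (modcD _ _))// lerD// modc_root_arg.
Qed.

Definition periodic2pi Q := forall z, Q (z + 'i * (pi *+ 2)%:C) = Q z.

Lemma root_argS N j : root_arg N j.+1 = root_arg N 1 + root_arg N j.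
Proof. by rewrite /root_arg -mulrDr -rmorphD/= -mulrDr -mulrDl -natr1 [1 + _]addrC. Qed.

(** The shift permutes the summands cyclically; the last one returns to the first by the period 2 pi
    i. *)
Lemma avg_period N Q z : periodic2pi Q ->
  avg N Q (z + root_arg N 1) = avg N Q z.
Proof.
case: N => [|N] Qp; first by rewrite /avg !big_ord0.
rewrite /avg; congr (_ * _); rewrite big_ord_recr [RHS]big_ord_recl/= addrC.
congr (_ + _).
  rewrite -addrA -root_argS /root_arg divff ?pnatr_eq0// mul0r mulr0 mulr1.
  by rewrite Qp rmorph0 mulr0 addr0.
by apply: eq_bigr => j _; rewrite -addrA -root_argS.
Qed.

Lemma avg_period_nat N Q z q : periodic2pi Q ->
  avg N Q (z + root_arg N q) = avg N Q z.
Proof.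
move=> Qp; elim: q z => [|q IH] z.
  by rewrite /root_arg mul0r mulr0 rmorph0 mulr0 addr0.
by rewrite root_argS addrA IH avg_period.
Qed.

Lemma floor_decomp (x s : R) : 0 <= x -> 0 < s ->
  exists q : nat, exists2 y, 0 <= y <= s & x = q%:R * s + y.
Proof.
move=> x0 s0; have xs0 : 0 <= x / s by rewrite divr_ge0// ltW.
exists (Num.truncn (x / s)), (x - (Num.truncn (x / s))%:R * s); last by ring.
have /andP[h1 h2] := truncn_itv xs0.
rewrite subr_ge0 -ler_pdivlMr// h1/= lerBlDr.
by move: h2; rewrite ltr_pdivrMr// -natr1 mulrDl mul1r addrC => /ltW.
Qed.

(** The average has period 2 pi i / N, so [y] can be reduced modulo 2 pi / N. The remainder is at
    most [d], and the modulus of continuity gives a bound that does not grow with [y]. *)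
Lemma avg_imag_ge0 N Q r d e z (y : R) : (0 < N)%N -> periodic2pi Q ->
  unif_modulus (avg N Q) r d e -> pi *+ 2 / N%:R <= d -> modc z + d <= r ->
  0 <= y -> modc (avg N Q (z + 'i * y%:C) - avg N Q z) <= e.
Proof.
move=> N0 Qp Gu Nd zr y0.
have s0 : 0 < pi *+ 2 / N%:R :> R by rewrite divr_gt0 ?ltr0n// mulrn_wgt0// pi_gt0.
have [q [t /andP[t0 ts] ->]] := floor_decomp y0 s0.
have -> : z + 'i * (q%:R * (pi *+ 2 / N%:R) + t)%:C =
    z + 'i * t%:C + root_arg N q.
  rewrite /root_arg -addrA -mulrDr -rmorphD/=; congr (z + 'i * _%:C); ring.
have td : modc ('i * t%:C) <= d.
  by rewrite modcM modci mul1r modcR ger0_norm// (le_trans ts).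
rewrite avg_period_nat//; apply: Gu.
- by rewrite (le_trans (modcD _ _))// (le_trans _ zr)// lerD2l.
- by rewrite (le_trans _ zr)// lerDl (le_trans _ td)// modc_ge0.
- by rewrite addrAC subrr add0r.
Qed.

Lemma avg_imag N Q r d e z : (0 < N)%N -> periodic2pi Q ->
  unif_modulus (avg N Q) r d e -> pi *+ 2 / N%:R <= d -> modc z + d <= r ->
  modc (avg N Q z - avg N Q (complex.Re z)%:C) <= e.
Proof.
move=> N0 Qp Gu Nd zr.
have [y0|y0] := leP 0 (complex.Im z).
  rewrite {1}(complexE z); apply: (avg_imag_ge0 (r := r) (d := d)) => //.
  by rewrite (le_trans _ zr)// lerD2r modcR modc_Re.
have -> : (complex.Re z)%:C = z + 'i * (- complex.Im z)%:C.
  by rewrite {2}(complexE z) rmorphN/= mulrN addrK.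
rewrite modc_sym; apply: (avg_imag_ge0 (r := r) (d := d)) => //.
by rewrite oppr_ge0 ltW.
Qed.

Lemma sum_shift (g : nat -> C) K q :
  \sum_(k < K) g (k + q)%N - \sum_(k < K) g k =
  \sum_(j < q) (g (K + j)%N - g j).
Proof.
elim: q => [|q IH].
  by rewrite big_ord0; under eq_bigr do rewrite addn0; rewrite subrr.
rewrite big_ord_recr/= -IH; case: K {IH} => [|K].
  by rewrite !big_ord0 add0n !subrr addr0.
rewrite big_ord_recr/= [X in _ = X - _ + _]big_ord_recl/= add0n.
rewrite (eq_bigr (fun k : 'I_K => g (bump 0 k + q)%N)); last first.
  by move=> k _; rewrite /bump/= addnS.
rewrite addSn addnS; ring.
Qed.

(** Multiplied by [s], this is a Riemann sum for the integral of G (t + z) over t in [a, a + s K],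
    whose derivative in the real direction at z = 0 would be G (a + s K) - G a. *)
Definition ladder G (a s : R) K (z : C) : C :=
  \sum_(k < K) G ((a + s * k%:R)%:C + z).

(* Shifting the argument by a step of the ladder telescopes the sum, so the
   ladder is nearly affine with slope the difference of [G] at its two ends. *)
Lemma ladder_shift_ge0 G a s K r d1 d2 e1 e2 B (x : R) :
  0 < s -> 0 <= e1 -> s <= d2 -> 0 <= x <= d1 ->
  unif_modulus G r d1 e1 -> unif_modulus G r d2 e2 ->
  (forall z, modc z <= r -> modc (G z) <= B) ->
  `|a| + s * K%:R + x <= r ->
  modc (s%:C * (ladder G a s K x%:C - ladder G a s K 0) -
        x%:C * (G (a + s * K%:R)%:C - G a%:C)) <=
  (s * K%:R) * e2 + 2 * x * e1 + 2 * s * B.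
Proof.
move=> s0 e10 sd2 /andP[x0 xd1] G1 G2 GB ar.
have sK0 : 0 <= s * K%:R by rewrite mulr_ge0// ltW.
have [q [t /andP[t0 ts] xE]] := floor_decomp x0 s0.
have qx : q%:R * s <= x by rewrite xE lerDl.
have inr (u : R) : `|u| <= `|a| + s * K%:R + x -> modc (u%:C : C) <= r.
  by move=> h; rewrite modcR (le_trans h).
have B0 : 0 <= B.
  apply: le_trans (GB a%:C _); rewrite ?modc_ge0// inr//.
  by rewrite -addrA lerDl addr_ge0.
pose g k := G (a + s * k%:R)%:C.
have L0 : ladder G a s K 0 = \sum_(k < K) g k.
  by apply: eq_bigr => k _; rewrite addr0.
have Lq : ladder G a s K (q%:R * s)%:C = \sum_(k < K) g (k + q)%N.
  apply: eq_bigr => k _; rewrite -rmorphD/= /g; congr (G _%:C).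
  by rewrite natrD; ring.
set Dl := G (a + s * K%:R)%:C - G a%:C.
(* The shift [x] is rounded down to [q] steps of length [s]. The remainder [t] moves every term of
   the ladder (cost s K e2), the [q] full steps telescope to increments near the two ends (cost 2 x
   e1), and t times the slope is left over (cost 2 s B). *)
have -> : s%:C * (ladder G a s K x%:C - ladder G a s K 0) - x%:C * Dl =
    s%:C * (ladder G a s K x%:C - ladder G a s K (q%:R * s)%:C) +
    s%:C * (\sum_(j < q) (g (K + j)%N - g j) - q%:R * Dl) - t%:C * Dl.
  have -> : x%:C = q%:R * s%:C + t%:C :> C.
    by rewrite {1}xE rmorphD rmorphM/= rmorph_nat.
  rewrite -sum_shift -Lq -L0; ring.
rewrite (le_trans (modcB _ _))// lerD//; last first.
  rewrite modcM modcR ger0_norm// [2 * s]mulrC -mulrA ler_pM ?modc_ge0//.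
  rewrite (le_trans (modcB _ _))// mulr_natl mulr2n lerD// GB// inr//.
    by rewrite (le_trans (ler_normD _ _))// (ger0_norm sK0) lerDl.
  by rewrite -addrA lerDl addr_ge0.
rewrite (le_trans (modcD _ _))// lerD//.
  rewrite modcM modcR gtr0_norm// -mulrA ler_wpM2l ?(ltW s0)// -sumrB.
  rewrite -[X in _ <= X%:R * _](card_ord K); apply: modc_sum_le => k; apply: G2.
  - rewrite -rmorphD/= inr// (le_trans (ler_normD _ _))// (ger0_norm x0) lerD2r.
    rewrite (le_trans (ler_normD _ _))// lerD2l ger0_norm ?mulr_ge0 ?(ltW s0)//.
    by rewrite ler_wpM2l ?(ltW s0)// ler_nat ltnW.
  - rewrite -rmorphD/= inr// (le_trans (ler_normD _ _))// lerD//; last first.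
      by rewrite ger0_norm// mulr_ge0// ltW.
    rewrite (le_trans (ler_normD _ _))// lerD2l ger0_norm ?mulr_ge0 ?(ltW s0)//.
    by rewrite ler_wpM2l ?(ltW s0)// ler_nat ltnW.
  - rewrite [X in modc X](_ : _ = t%:C); last first.
      by rewrite -!rmorphD/= -rmorphB/= {1}xE; congr (_%:C); ring.
    by rewrite modcR ger0_norm// (le_trans ts).
rewrite modcM modcR gtr0_norm//.
apply: (@le_trans _ _ (s * (q%:R * (2 * e1)))); last first.
  rewrite [leLHS](_ : _ = 2 * (q%:R * s) * e1); last by ring.
  by rewrite ler_wpM2r// ler_wpM2l.
rewrite ler_wpM2l ?(ltW s0)//.
have -> : \sum_(j < q) (g (K + j)%N - g j) - q%:R * Dl =
    \sum_(j < q) (g (K + j)%N - g j - Dl).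
  by rewrite [RHS]sumrB sumr_const card_ord mulr_natl.
rewrite -[X in _ <= X%:R * _](card_ord q); apply: modc_sum_le => j.
have jx : s * j%:R <= x.
  by rewrite (le_trans _ qx)// mulrC ler_wpM2r ?(ltW s0)// ler_nat ltnW.
have sj0 : 0 <= s * j%:R by rewrite mulr_ge0// ltW.
have -> : g (K + j)%N - g j - Dl = (g (K + j)%N - G (a + s * K%:R)%:C) -
   (g j - G a%:C) by rewrite /Dl; ring.
rewrite (le_trans (modcB _ _))// mulr_natl mulr2n lerD//; apply: G1.
- rewrite inr// natrD mulrDr addrA (le_trans (ler_normD _ _))// (ger0_norm sj0).
  by rewrite lerD// (le_trans (ler_normD _ _))// (ger0_norm sK0).
- by rewrite inr// (le_trans (ler_normD _ _))// (ger0_norm sK0) lerDl.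
- rewrite -rmorphB/= modcR [X in `|X|](_ : _ = s * j%:R); last by rewrite natrD; ring.
  by rewrite ger0_norm// (le_trans jx).
- rewrite inr// (le_trans (ler_normD _ _))// (ger0_norm sj0) -addrA lerD2l.
  by rewrite (le_trans jx)// lerDr.
- by rewrite inr// -addrA lerDl addr_ge0.
- rewrite -rmorphB/= modcR [X in `|X|](_ : _ = s * j%:R); last by ring.
  by rewrite ger0_norm// (le_trans jx).
Qed.

(** A negative shift is undone by the positive shift [- x] of the ladder that starts at [a + x].
    Both ends of that ladder are off by |x| <= d1, which costs another 2 |x| e1 and explains the
    factor 4. *)
Lemma ladder_shift_real G a s K r d1 d2 e1 e2 B (x : R) :
  0 < s -> 0 <= e1 -> s <= d2 -> `|x| <= d1 ->
  unif_modulus G r d1 e1 -> unif_modulus G r d2 e2 ->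
  (forall z, modc z <= r -> modc (G z) <= B) ->
  `|a| + s * K%:R + 2 * `|x| <= r ->
  modc (s%:C * (ladder G a s K x%:C - ladder G a s K 0) -
        x%:C * (G (a + s * K%:R)%:C - G a%:C)) <=
  (s * K%:R) * e2 + 4 * `|x| * e1 + 2 * s * B.
Proof.
move=> s0 e10 sd2 xd1 G1 G2 GB ar.
have sK0 : 0 <= s * K%:R by rewrite mulr_ge0// ltW.
have [x0|x0] := leP 0 x.
  move: xd1 ar; rewrite (ger0_norm x0) => xd1 ar.
  have xd : 0 <= x <= d1 by rewrite x0.
  have ar' : `|a| + s * K%:R + x <= r by lra.
  have := @ladder_shift_ge0 G a s K r d1 d2 e1 e2 B x s0 e10 sd2 xd G1 G2 GB ar'.
  by have : 0 <= x * e1 by [rewrite mulr_ge0|]; lra.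
move: xd1 ar; rewrite (ltr0_norm x0) => xd1 ar.
have xd : 0 <= - x <= d1 by rewrite oppr_ge0 ltW.
have aa : `|a + x| <= `|a| - x.
  by rewrite (le_trans (ler_normD _ _))// lerD2l ltr0_norm.
have ar' : `|a + x| + s * K%:R + - x <= r by lra.
have := @ladder_shift_ge0 G (a + x) s K r d1 d2 e1 e2 B (- x) s0 e10 sd2 xd G1 G2 GB ar'.
have -> : ladder G (a + x) s K (- x)%:C = ladder G a s K 0.
  apply: eq_bigr => k _; rewrite addr0 -rmorphD/=; congr (G _%:C); ring.
have -> : ladder G (a + x) s K 0 = ladder G a s K x%:C.
  apply: eq_bigr => k _; rewrite addr0 -rmorphD/=; congr (G _%:C); ring.
set T := (X in modc X <= _) => TE.
rewrite [X in modc X](_ : _ = - T + x%:C *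
   ((G (a + x + s * K%:R)%:C - G (a + s * K%:R)%:C) - (G (a + x)%:C - G a%:C))); last first.
  by rewrite /T rmorphN/=; ring.
have xx : modc (x%:C : C) = - x by rewrite modcR ltr0_norm.
have inr (u : R) : `|u| <= `|a| + s * K%:R - x -> modc (u%:C : C) <= r.
  by move=> h; rewrite modcR; lra.
have a0 := normr_ge0 a.
apply: (@le_trans _ _ (modc T + - x * (e1 + e1))); last by lra.
rewrite (le_trans (modcD _ _))// modcN lerD2l modcM xx ler_wpM2l//; first by lra.
have asK : `|a + s * K%:R| <= `|a| + s * K%:R.
  by rewrite (le_trans (ler_normD _ _))// (ger0_norm sK0).
have axsK : `|a + x + s * K%:R| <= `|a + x| + s * K%:R.
  by rewrite (le_trans (ler_normD _ _))// (ger0_norm sK0).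
rewrite (le_trans (modcB _ _))// lerD//; apply: G1.
- by apply: inr; lra.
- by apply: inr; lra.
- by rewrite -rmorphB/= (_ : _ - _ = x) ?xx//; ring.
- by apply: inr; lra.
- by apply: inr; lra.
- by rewrite -rmorphB/= (_ : _ - _ = x) ?xx//; ring.
Qed.

(** The imaginary part of [z] is dropped term by term, at the price of a second s K e2. The limit is
    then a multiple of Re z, which is not holomorphic: this is where conjugation enters. *)
Lemma ladder_shift G a s K r d1 d2 e1 e2 B (z : C) :
  0 < s -> 0 <= e1 -> s <= d2 -> modc z <= d1 ->
  unif_modulus G r d1 e1 -> unif_modulus G r d2 e2 ->
  (forall z, modc z <= r -> modc (G z) <= B) ->
  (forall z, modc z + d2 <= r -> modc (G z - G (complex.Re z)%:C) <= e2) ->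
  `|a| + s * K%:R + 2 * modc z + d2 <= r ->
  modc (s%:C * (ladder G a s K z - ladder G a s K 0) -
        (complex.Re z)%:C * (G (a + s * K%:R)%:C - G a%:C)) <=
  2 * (s * K%:R) * e2 + 4 * modc z * e1 + 2 * s * B.
Proof.
move=> s0 e10 sd2 zd1 G1 G2 GB Gi ar.
have sK0 : 0 <= s * K%:R by rewrite mulr_ge0// ltW.
set x := complex.Re z.
have xz : `|x| <= modc z := modc_Re z.
have xd : `|x| <= d1 := le_trans xz zd1.
have ar' : `|a| + s * K%:R + 2 * `|x| <= r by lra.
have := @ladder_shift_real G a s K r d1 d2 e1 e2 B x s0 e10 sd2 xd G1 G2 GB ar'.
set T := (X in modc X <= _) => TE.
rewrite [X in modc X](_ : _ = s%:C * (ladder G a s K z - ladder G a s K x%:C) + T); last first.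
  by rewrite /T; ring.
have xe : 4 * `|x| * e1 <= 4 * modc z * e1 by rewrite ler_wpM2r// ler_wpM2l.
apply: (@le_trans _ _ (s * K%:R * e2 + modc T)); last by lra.
rewrite (le_trans (modcD _ _))// lerD2r modcM modcR gtr0_norm// -mulrA.
rewrite ler_wpM2l ?(ltW s0)// -sumrB -[X in _ <= X%:R * _](card_ord K).
apply: modc_sum_le => k.
have -> : (a + s * k%:R)%:C + x%:C =
    (complex.Re ((a + s * k%:R)%:C + z))%:C :> C by rewrite ReD/= [RHS]rmorphD.
apply: Gi; rewrite (le_trans _ ar)// lerD2r (le_trans (modcD _ _))//.
have : modc ((a + s * k%:R)%:C : C) <= `|a| + s * K%:R.
  rewrite modcR (le_trans (ler_normD _ _))// lerD2l.
  rewrite ger0_norm ?mulr_ge0 ?(ltW s0)//.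
  by rewrite ler_wpM2l ?(ltW s0)// ler_nat ltnW.
by have := modc_ge0 z; lra.
Qed.

End CircleAverages.

(** * Zooming into a ladder to isolate the real part *)

Section Slope.
Variable R : realType.
Local Notation C := R[i].

Definition translates_comb (Q : C -> C) (psi : C -> C) :=
  exists (I : finType) (c b : I -> C),
    forall z, psi z = \sum_i c i * Q (z + b i).

Lemma ladder_comb (Q : C -> C) N a s K c :
  translates_comb Q (fun z => c * ladder (avg N Q) a s K z).
Proof.
exists ('I_K * 'I_N)%type, (fun=> c * N%:R^-1),
  (fun p : 'I_K * 'I_N => (a + s * p.1%:R)%:C + root_arg R N p.2) => z.
rewrite /ladder mulr_sumr.
rewrite -(pair_bigA _ (fun (k : 'I_K) (j : 'I_N) =>
  c * N%:R^-1 * Q (z + ((a + s * k%:R)%:C + root_arg R N j))))/=.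
apply: eq_bigr => k _; rewrite /avg mulrA mulr_sumr; apply: eq_bigr => j _.
by congr (_ * Q _); ring.
Qed.

(** Asked only for arbitrarily large N, so that its failure for every [k] says that the difference
    tends to 0, with no assumption that the averages converge. *)
Definition oscillates (G : nat -> C -> C) (x1 x2 k : R) :=
  forall N0, exists2 N, (N0 <= N)%N & k <= modc (G N x2%:C - G N x1%:C).

(** The ladder from [x1] to [x2], divided by its slope [Dl] with |Dl| >= k, is nearly Re z up to a
    constant; rescaling by [h] makes the error small. The bound on [psi 0] is fixed before [h],
    since the application multiplies [psi 0] by an error relative to [h]. *)
Lemma slope_comb (Q : C -> C) (x1 x2 k : R) : ucont Q -> periodic2pi Q ->
  x1 < x2 -> 0 < k -> oscillates (fun N => avg N Q) x1 x2 k ->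
  exists2 B : R, 0 < B & forall rr e h0 : R, 1 <= rr -> 0 < e -> 0 < h0 ->
    exists (h : R) (psi : C -> C), [/\ 0 < h <= h0, translates_comb Q psi,
      modc (psi 0) <= B & forall z, modc z <= rr ->
        modc (h^-1%:C * (psi (h%:C * z) - psi 0) - (complex.Re z)%:C) <= e].
Proof.
move=> uQ pQ x12 k0 osc.
pose L := x2 - x1; have L0 : 0 < L by rewrite subr_gt0.
(* The ladder reaches |x1| + L, the argument needs room 2 |h z| <= 2, and [d2] is at most 1. *)
pose r := `|x1| + L + 3.
have [B B0 QB] := ucont_bounded uQ (r + 8).
exists (L * B / k + 1).
  by rewrite ltr_wpDl// divr_ge0 ?(ltW k0)// mulr_ge0// ltW.
move=> rr e h0 rr1 e0 h00; have rr0 : 0 < rr by lra.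
pose e1 := e * k / (16 * rr).
have e10 : 0 < e1 by rewrite divr_gt0 ?mulr_gt0.
have [d1 d10 Q1] := uQ (r + 8) e1 e10.
pose h := Num.min h0 (Num.min (d1 / rr) rr^-1).
have h_gt0 : 0 < h by rewrite !lt_min h00 divr_gt0//= invr_gt0.
have [hh0 [hd1 h1]] : h <= h0 /\ h * rr <= d1 /\ h * rr <= 1.
  rewrite -!ler_pdivlMr// mul1r /h !ge_min !lexx !orbT; split=> //.
(* The errors governed by [e2] and by the step [s] do not shrink with [h], so both are chosen after
   [h] and proportionally to it. Each of the three error terms is then at most e h k / 4. *)
pose e2 := e * h * k / (8 * L).
have ehk : 0 < e * h * k by rewrite !mulr_gt0.
have e20 : 0 < e2 by rewrite divr_gt0// mulr_gt0.
have [d' d'0 Q2'] := uQ (r + 8) e2 e20.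
pose d2 := Num.min d' 1.
have d20 : 0 < d2 by rewrite lt_min d'0/=.
have [d2d' d21] : d2 <= d' /\ d2 <= 1 by rewrite /d2 !ge_min !lexx orbT.
have Q2 : unif_modulus Q (r + 8) d2 e2.
  by move=> x y xr yr xy; apply: Q2' => //; exact: le_trans xy d2d'.
pose s0 := Num.min d2 (e * h * k / (8 * (B + 1))).
have s00 : 0 < s0 by rewrite lt_min d20 divr_gt0// mulr_gt0// ltr_wpDl.
have [K K0 LK] := exists_nat_inv_lt L s00.
have {LK} := LK K (leqnn _); set s := L / K%:R => ss0.
have KR : 0 < K%:R :> R by rewrite ltr0n.
have s_gt0 : 0 < s by rewrite divr_gt0.
have sK : s * K%:R = L by rewrite divfK// lt0r_neq0.
have [sd2 sB] : s <= d2 /\ s * (8 * (B + 1)) <= e * h * k.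
  split; first by rewrite (le_trans ss0)// ge_min lexx.
  by rewrite -ler_pdivlMr ?mulr_gt0 ?ltr_wpDl// (le_trans ss0)// ge_min lexx orbT.
have [N0 N00 Nd] := exists_nat_inv_lt (pi *+ 2) d20.
have [N NN0 kD] := osc N0.
have N_gt0 : (0 < N)%N by rewrite (leq_trans N00).
set G := avg N Q in kD.
have G1 : unif_modulus G r d1 e1 := avg_modulus N_gt0 Q1.
have G2 : unif_modulus G r d2 e2 := avg_modulus N_gt0 Q2.
have GB : forall z, modc z <= r -> modc (G z) <= B := avg_bound N_gt0 QB.
have Gi z : modc z + d2 <= r -> modc (G z - G (complex.Re z)%:C) <= e2.
  by apply: avg_imag => //; exact: Nd.
set Dl := G x2%:C - G x1%:C in kD.
have Dl0 : Dl != 0.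
  by apply/eqP => D0; move: kD; rewrite D0 modc0 leNgt k0.
have mDl := modc_gt0 Dl0.
pose c := s%:C / Dl.
exists h, (fun z => c * ladder G x1 s K z); split.
- by rewrite h_gt0.
- exact: ladder_comb.
- rewrite modcM modcM modcV modcR gtr0_norm//.
  have lB : modc (ladder G x1 s K 0) <= K%:R * B.
    rewrite -[X in _ <= X%:R * _](card_ord K); apply: modc_sum_le => j.
    apply: GB; rewrite addr0 modcR /r.
    rewrite (le_trans (ler_normD _ _))//.
    have sj0 : 0 <= s * j%:R by rewrite mulr_ge0 ?(ltW s_gt0).
    have : s * j%:R <= L by rewrite -sK ler_wpM2l ?(ltW s_gt0)// ler_nat ltnW.
    by rewrite (ger0_norm sj0); lra.
  apply: (@le_trans _ _ (s / k * (K%:R * B))).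
    apply: ler_pM => //; rewrite ?modc_ge0//.
      by rewrite divr_ge0 ?modc_ge0 ?(ltW s_gt0).
    by rewrite ler_wpM2l ?(ltW s_gt0)// lef_pV2 ?posrE.
  rewrite [leLHS](_ : _ = s * K%:R * B / k); last by ring.
  by rewrite sK lerDl.
move=> z zr.
have hz : modc (h%:C * z) <= h * rr.
  by rewrite modcM modcR gtr0_norm// ler_wpM2l// ltW.
have rad : `|x1| + s * K%:R + 2 * modc (h%:C * z) + d2 <= r.
  by rewrite sK /r; lra.
have := @ladder_shift R G x1 s K r d1 d2 e1 e2 B (h%:C * z) s_gt0 (ltW e10) sd2
  (le_trans hz hd1) G1 G2 GB Gi rad.
have -> : (x1 + s * K%:R) = x2 by rewrite sK /L; ring.
rewrite -/Dl.
have -> : (complex.Re (h%:C * z))%:C = h%:C * (complex.Re z)%:C :> C.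
  by case: (z) => u v; rewrite -rmorphM/= mul0r subr0.
set T := (X in modc X <= _) => TE.
have hC0 : h%:C != 0 :> C by rewrite -(rmorph0 (real_complex R)) (inj_eq (@complexI R)) lt0r_neq0.
rewrite [X in modc X](_ : _ = (h%:C)^-1 * Dl^-1 * T); last first.
  by rewrite /T /c fmorphV/=; field; apply/andP; split => //; exact: hC0.
rewrite !modcM !modcV modcR gtr0_norm//.
rewrite -mulrA ler_pdivrMl// ler_pdivrMl//.
apply: (le_trans TE).
rewrite sK.
have E1 : 4 * modc (h%:C * z) * e1 <= e * h * k / 4.
  apply: (@le_trans _ _ (4 * (h * rr) * e1)).
    by rewrite ler_wpM2r ?(ltW e10)// ler_wpM2l.
  by rewrite /e1 le_eqVlt; apply/orP; left; apply/eqP; field; rewrite lt0r_neq0.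
have E2 : 2 * L * e2 = e * h * k / 4 by rewrite /e2; field; rewrite lt0r_neq0.
have E3 : 2 * s * B <= e * h * k / 4.
  by have := ltW s_gt0; nra.
have : k * (h * e) <= modc Dl * (h * e) by rewrite ler_wpM2r// mulr_ge0 ?ltW.
have : 0 <= e * h * k by exact: ltW.
lra.
Qed.

End Slope.

(** * Conjugation from an oscillating average *)

Section Conjugation.
Variable R : realType.
Local Notation C := R[i].
Variable rho : C -> C.
Hypothesis urho : ucont rho.

(** What can be had from a value x in the scratch register without forming sums: apply exp and then
    [rho] after an affine map, keep x, or ignore it. *)
Definition exp_chains : set (C -> C) :=
  [set f | (exists a b : C, f = fun x => rho (cexp (a * x + b))) \/
           f = (fun=> 1) \/ f = id].

(** For an integer [mu] and a real x, [avg N (twist mu)] at x is the N-point quadrature of e^(-mu x)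
    times the mu-th Fourier coefficient of [rho] on the circle of radius e^x. *)
Definition twist (mu : C) (x : C) : C := cexp (- mu * x) * rho (cexp x).

Lemma ucont_twist mu : ucont (twist mu).
Proof.
apply: ucont_mul; last exact: ucont_comp (@ucont_cexp R).
apply: (ucont_comp (@ucont_cexp R)) => r e e0.
have [d d0 H] := ucont_affine (- mu) 0 r e0.
by exists d => // x y xr yr xy; have := H x y xr yr xy; rewrite !addr0.
Qed.

Lemma oscillates_conj mu x1 x2 k : periodic2pi (twist mu) ->
  x1 < x2 -> 0 < k -> oscillates (fun N => avg N (twist mu)) x1 x2 k ->
  forall r, closed_span [set z | modc z <= r] exp_chains (fun z => z^*).
Proof.
move=> pQ x12 k0 osc r; set D := (X in closed_span X).
have HS := closed_span_subspace D exp_chains.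
have Sid : closed_span D exp_chains id by apply: sub_closed_span; right; right.
have S1 : closed_span D exp_chains (fun=> 1).
  by apply: sub_closed_span; right; left.
suff SRe : closed_span D exp_chains (fun z => (complex.Re z)%:C).
  apply: (subspace_eq HS _ (subspaceB HS (subspaceZ HS 2 SRe) Sid)) => z _.
  by rewrite -addcJ addrC addKr.
have [B B0 HB] := slope_comb (ucont_twist mu) pQ x12 k0 osc.
apply: (subspace_lim HS) => e e0.
pose rr := `|r| + 1; have rr1 : 1 <= rr by rewrite lerDr.
have rr0 : 0 < rr by rewrite (lt_le_trans ltr01).
have Drr z : D z -> modc z <= rr.
  by move=> Dz; rewrite (le_trans Dz)// (le_trans (ler_norm r))// lerDl.
pose m := modc mu; have m0 : 0 <= m := modc_ge0 mu.
have mrr0 : 0 < (m * rr + 1) * B by rewrite mulr_gt0// ltr_wpDl// mulr_ge0// ltW.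
have e30 : 0 < e / 3 by rewrite divr_gt0.
have [d0 d00 H0] := cexp_diff0 (divr_gt0 e30 mrr0).
pose eu := Num.min 1 (e / 3 / rr).
have eu0 : 0 < eu by rewrite lt_min/= ltr01 divr_gt0.
have [d1 d10 H1] := @ucont_cexp R 1 eu eu0.
pose h0 := Num.min d0 (Num.min d1 1) / (m * rr + 1).
have mr1 : 0 < m * rr + 1 by rewrite ltr_wpDl// mulr_ge0// ltW.
have h00 : 0 < h0 by rewrite divr_gt0// !lt_min d00 d10/=.
have e60 : 0 < e / 6 by rewrite divr_gt0.
have [h [psi [/andP[h_gt0 hh0] psiC psiB psiE]]] := HB rr (e / 6) h0 rr1 e60 h00.
have hm : h * (m * rr + 1) <= Num.min d0 (Num.min d1 1).
  by rewrite -ler_pdivlMr.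
pose E z := cexp (mu * (h%:C * z)) * psi (h%:C * z).
have SE : closed_span D exp_chains E.
  have [I [c [b psiS]]] := psiC.
  apply: (subspace_eq HS (f := fun z => \sum_i (c i * cexp (- mu * b i)) * rho (cexp (h%:C * z + b i)))).
    move=> z _; rewrite /E psiS mulr_sumr; apply: eq_bigr => i _.
    rewrite /twist [RHS]mulrCA [X in _ = _ * X]mulrA -cexpD [RHS]mulrA.
    by congr (_ * cexp _ * _); ring.
  apply: (subspace_sum HS) => i _; apply: (subspaceZ HS).
  by apply: sub_closed_span; left; exists h%:C, (b i).
exists (fun z => h^-1%:C * (E z - psi 0 * 1) - (mu * psi 0) * z).
  apply: (subspaceB HS); last exact: (subspaceZ HS).
  apply: (subspaceZ HS); apply: (subspaceB HS SE).
  exact: (subspaceZ HS (psi 0) S1).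
move=> z Dz; have zr := Drr z Dz.
have hC0 : h%:C != 0 :> C.
  by rewrite -(rmorph0 (real_complex R)) (inj_eq (@complexI R)) lt0r_neq0.
pose y := mu * (h%:C * z).
have my : modc y <= h * (m * rr).
  rewrite /y !modcM modcR gtr0_norm// mulrCA ler_wpM2l ?(ltW h_gt0)//.
  by rewrite ler_wpM2l.
have : h * (m * rr) <= Num.min d0 (Num.min d1 1).
  by apply: le_trans hm; rewrite ler_wpM2l ?(ltW h_gt0)// lerDl.
rewrite !le_min => /andP[hd0 /andP[hd1 hd2]].
have Y0 := H0 y (le_trans my hd0).
have Y1 : modc (cexp y - 1) <= eu.
  rewrite -(@cexp0 R); apply: H1; rewrite ?modc0 ?subr0//.
    exact: le_trans my hd2.
  exact: le_trans my hd1.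
have [eu1 eu2] : eu <= 1 /\ eu <= e / 3 / rr by rewrite /eu !ge_min !lexx orbT.
have Y2 : modc (cexp y) <= 2.
  by have := modc_le_add (cexp y) 1; rewrite modc1; lra.
have P := psiE z zr.
set U := h^-1%:C * _ - _ in P.
rewrite [X in modc X](_ : _ = cexp y * U + (cexp y - 1) * (complex.Re z)%:C
  + h^-1%:C * ((cexp y - 1 - y) * psi 0)); last first.
  rewrite /U /E -/y /y fmorphV/=; field; exact: hC0.
rewrite (le_trans (modcD _ _))// (_ : e = 2 * (e / 6) + e / 3 + e / 3); last by field.
rewrite lerD//.
  rewrite (le_trans (modcD _ _))// lerD// modcM; first by rewrite ler_pM ?modc_ge0.
  rewrite modcR -[leRHS](divfK (lt0r_neq0 rr0)) ler_pM ?modc_ge0//.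
    exact: le_trans eu2.
  by rewrite (le_trans (modc_Re _)).
rewrite !modcM modcR gtr0_norm ?invr_gt0// ler_pdivrMl//.
apply: (@le_trans _ _ (e / 3 / ((m * rr + 1) * B) * (h * (m * rr + 1)) * B)).
  rewrite ler_pM ?modc_ge0// (le_trans Y0)// ler_wpM2l//.
    by rewrite divr_ge0 ?ltW.
  by rewrite (le_trans my)// ler_wpM2l ?(ltW h_gt0)// lerDl.
rewrite le_eqVlt; apply/orP; left; apply/eqP; field.
by rewrite lt0r_neq0//= lt0r_neq0.
Qed.

End Conjugation.

(** * Fejer summation *)

Section Fejer.
Variable R : realType.
Local Notation C := R[i].

Lemma cexp_i (t : R) : cexp ('i * t%:C) = cos t +i* sin t :> C.
Proof.
rewrite /cexp/= !(mul0r, mul1r, mulr0, subr0, add0r, addr0) oppr0 expR0.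
by rewrite mul1r.
Qed.

Lemma cexp_root_arg_neq1 N j : (0 < j < N)%N -> cexp (root_arg R N j) != 1.
Proof.
move=> /andP[j0 jN].
pose t : R := pi * (j%:R / N%:R).
have Nn : (0 < N)%N by rewrite (leq_trans _ jN).
have N0 : 0 < N%:R :> R by rewrite ltr0n.
have st : 0 < sin t.
  apply: sin_gt0_pi; rewrite mulr_gt0 ?pi_gt0 ?divr_gt0 ?ltr0n//=.
  by rewrite gtr_pMr ?pi_gt0// ltr_pdivrMr// mul1r ltr_nat.
have -> : root_arg R N j = 'i * (t *+ 2)%:C.
  by rewrite /root_arg /t; congr ('i * _%:C); ring.
rewrite cexp_i; apply/eqP => -[] ct _; have := cos_mulr2n t; rewrite ct cos2sin2.
move: (exprn_gt0 2 st); lra.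
Qed.

Lemma cexp_root_argX N j : (0 < N)%N -> cexp (root_arg R N j) ^+ N = 1.
Proof.
move=> N0; rewrite -cexp_natM.
have -> : N%:R * root_arg R N j = j%:R * ('i * (pi *+ 2)%:C).
  rewrite /root_arg mulrCA [RHS]mulrCA; congr ('i * _).
  rewrite -!(rmorph_nat (real_complex R)) -!rmorphM/=; congr (_%:C).
  by rewrite mulrCA [N%:R * _]mulrC divfK ?pnatr_eq0 -?lt0n// mulrC.
by rewrite cexp_natM -[X in cexp X]add0r cexp_2pi cexp0 expr1n.
Qed.

Lemma geo_root (q : C) N : q != 1 -> q ^+ N = 1 -> \sum_(j < N) q ^+ j = 0.
Proof.
move=> q1 qN; have := subrX1 q N; rewrite qN subrr => /esym/eqP.
by rewrite mulf_eq0 subr_eq0 (negbTE q1)/= => /eqP.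
Qed.

Lemma root_sum N j : (0 < j < N)%N ->
  \sum_(i < N) cexp (j%:R * root_arg R N i) = 0.
Proof.
move=> jN; have N0 : (0 < N)%N by case/andP: jN => _ /(leq_trans _); exact.
rewrite -[RHS](geo_root (cexp_root_arg_neq1 jN) (cexp_root_argX _ N0)).
apply: eq_bigr => i _; rewrite -cexp_natM; congr cexp.
rewrite /root_arg mulrCA [RHS]mulrCA; congr ('i * _).
by rewrite -!(rmorph_nat (real_complex R)) -!rmorphM/=; congr (_%:C); ring.
Qed.

Lemma conj_root_arg N j (n : R) : (n%:C * root_arg R N j)^* = - (n%:C * root_arg R N j).
Proof.
rewrite /root_arg; apply/eqP; rewrite eq_complex/=; apply/andP; split; apply/eqP; ring.
Qed.

Lemma conj_cexp_root N j k :
  (cexp (k%:R * root_arg R N j))^* = cexp (- (k%:R * root_arg R N j)).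
Proof.
by rewrite cexp_conj -(rmorph_nat (real_complex R)) conj_root_arg.
Qed.

(** As k, l < N, the difference k - l is never a nonzero multiple of N, so there is no aliasing. The
    case k > l is the conjugate of a sum with natural exponents. *)
Lemma root_orthogonal N k l : (k < N)%N -> (l < N)%N ->
  \sum_(i < N) cexp (- (k%:R - l%:R) * root_arg R N i) = N%:R * (k == l)%:R.
Proof.
move=> kN lN; case: (ltngtP k l) => kl.
- rewrite mulr0 -[RHS](@root_sum N (l - k)%N); last first.
    by rewrite subn_gt0 kl (leq_ltn_trans _ lN)// leq_subr.
  by apply: eq_bigr => i _; rewrite natrB ?(ltnW kl)// opprB.
- have klN : (0 < k - l < N)%N.
    by rewrite subn_gt0 kl (leq_ltn_trans _ kN)// leq_subr.
  have := congr1 (@conjc R) (root_sum klN); rewrite rmorph_sum conjc0 => h; rewrite mulr0 -[RHS]h.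
  apply: eq_bigr => i _.
  by rewrite [RHS]conj_cexp_root natrB ?(ltnW kl)// mulNr.
- rewrite kl subrr oppr0 mulr1; under eq_bigr do rewrite mul0r cexp0.
  by rewrite sumr_const card_ord.
Qed.

Definition dirichlet N M (j : nat) : C :=
  \sum_(k < M) cexp (k%:R * root_arg R N j).

(** The Fejer kernel of order M sampled at the N-th roots of unity, normalised so that its values
    are probability weights. *)
Definition fejer N M (j : nat) : R :=
  (N%:R * M%:R)^-1 * modc (dirichlet N M j) ^+ 2.

Lemma fejer_ge0 N M j : 0 <= fejer N M j.
Proof. by rewrite mulr_ge0 ?invr_ge0 ?exprn_ge0 ?modc_ge0// mulr_ge0. Qed.

Lemma fejerE N M j : (fejer N M j)%:C = (N%:R * M%:R)^-1 *
  \sum_(k < M) \sum_(l < M) cexp (- (k%:R - l%:R) * root_arg R N j).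
Proof.
rewrite /fejer rmorphM/= fmorphV rmorphM/= !rmorph_nat modc_sqr; congr (_ * _).
rewrite mulrC /dirichlet rmorph_sum/= mulr_suml; apply: eq_bigr => k _.
rewrite mulr_sumr; apply: eq_bigr => l _; rewrite [X in X * _ = _](conj_cexp_root N j k) -cexpD.
by congr cexp; ring.
Qed.

(** In the expanded square only the M diagonal pairs k = l survive orthogonality; M <= N keeps all
    indices below N. *)
Lemma fejer_sum N M : (0 < M)%N -> (M <= N)%N -> \sum_(j < N) fejer N M j = 1.
Proof.
move=> M0 MN; apply: (@complexI R); rewrite rmorph_sum/=.
under eq_bigr do rewrite fejerE.
rewrite -mulr_sumr exchange_big/=.
under eq_bigr do rewrite exchange_big/=.
have Nn0 : N%:R != 0 :> C by rewrite pnatr_eq0 -lt0n (leq_trans M0).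
have Mn0 : M%:R != 0 :> C by rewrite pnatr_eq0 -lt0n.
rewrite (eq_bigr (fun=> N%:R)); last first.
  move=> k _; rewrite (eq_bigr (fun l : 'I_M => N%:R * (k == l :> nat)%:R)); last first.
    by move=> l _; rewrite root_orthogonal// (leq_trans _ MN).
  rewrite -mulr_sumr (bigD1 k)//= eqxx big1 ?addr0 ?mulr1// => l lk.
  by rewrite eq_sym (negbTE (lk : l != k :> nat)).
by rewrite sumr_const card_ord -[N%:R *+ M]mulr_natr mulVf// mulf_neq0.
Qed.

(** Multiplication by u - 1, with u the root, collapses the geometric sum to u^M - 1, of modulus at
    most 2. Each of the N terms is thus at most 4 / (N M). This is the concentration of the kernel
    near u = 1. *)
Lemma fejer_variance N M : (0 < M)%N -> (0 < N)%N ->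
  \sum_(j < N) fejer N M j * modc (cexp (root_arg R N j) - 1) ^+ 2 <= 4 / M%:R.
Proof.
move=> M0 N0.
have NM0 : 0 < N%:R * M%:R :> R by rewrite mulr_gt0 ?ltr0n.
apply: (@le_trans _ _ (\sum_(j < N) (N%:R * M%:R)^-1 * 4)); last first.
  rewrite sumr_const card_ord -mulr_natl le_eqVlt; apply/orP; left; apply/eqP.
  by field; rewrite !pnatr_eq0 -!lt0n M0.
apply: ler_sum => j _.
rewrite /fejer -mulrA ler_wpM2l ?invr_ge0 ?(ltW NM0)// -exprMn -modcM.
have -> : dirichlet N M j * (cexp (root_arg R N j) - 1) =
    cexp (M%:R * root_arg R N j) - 1.
  rewrite cexp_natM subrX1 mulrC; congr (_ * _).
  by apply: eq_bigr => k _; rewrite cexp_natM.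
have cm : modc (cexp (M%:R * root_arg R N j)) = 1.
  rewrite modc_cexp [X in expR X](_ : _ = 0) ?expR0//.
  by rewrite -(rmorph_nat (real_complex R)) /root_arg/=; ring.
have := modcB (cexp (M%:R * root_arg R N j)) 1; rewrite cm modc1 => h.
have -> : 4 = 2 ^+ 2 :> R by rewrite -natrX.
by rewrite lerXn2r ?nnegrE ?modc_ge0// (le_trans h).
Qed.

End Fejer.

(** * Fourier coefficients on circles when no average oscillates *)

Section Flat.
Variable R : realType.
Local Notation C := R[i].
Variable rho : C -> C.
Hypothesis urho : ucont rho.
Variable B : R.
Hypothesis rhoB : forall z, modc z <= 1 -> modc (rho z) <= B.
Local Notation Q k l := (twist rho (k%:R - l%:R)).

(** The integer mu appears as k - l with natural k and l because pairs (k, l) index the double sum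
    of the Fejer kernel. *)
Hypothesis flat : forall (k l : nat) (x1 x2 e : R), x1 < x2 -> 0 < e ->
  exists N0, forall N, (N0 <= N)%N ->
    modc (avg N (Q k l) x2%:C - avg N (Q k l) x1%:C) <= e.

Lemma flat_sym k l (x1 x2 e : R) : 0 < e -> exists N0, forall N, (N0 <= N)%N ->
  modc (avg N (Q k l) x2%:C - avg N (Q k l) x1%:C) <= e.
Proof.
move=> e0; case: (ltgtP x1 x2) => [x12|x21|->]; first exact: flat.
  by have [N0 H] := flat k l x21 e0; exists N0 => N /H; rewrite modc_sym.
by exists 0%N => N _; rewrite subrr modc0 ltW.
Qed.

Lemma disc_bound_ge0 : 0 <= B.
Proof. by rewrite (le_trans (modc_ge0 (rho 0)))// rhoB ?modc0. Qed.

Lemma cexp_natM_2pi (k : nat) : cexp (k%:R * ('i * (pi *+ 2)%:C)) = 1 :> C.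
Proof. by rewrite cexp_natM -[X in cexp X]add0r cexp_2pi cexp0 expr1n. Qed.

Lemma twist_periodic (k l : nat) : periodic2pi (Q k l).
Proof.
move=> z; rewrite /twist cexp_2pi; congr (_ * _).
rewrite mulrDr cexpD [X in _ * X](_ : _ = 1) ?mulr1//.
by rewrite opprB mulrBl cexpB !cexp_natM_2pi divr1.
Qed.

Lemma Re_root_arg N j (x : R) : complex.Re (x%:C + root_arg R N j) = x.
Proof. by rewrite ReD /root_arg/=; ring. Qed.

Lemma Re_cmulR (mu x : C) : complex.Im mu = 0 ->
  complex.Re (mu * x) = complex.Re mu * complex.Re x.
Proof. by case: mu => a b /= ->; case: x => c d /=; rewrite mul0r subr0. Qed.

Lemma Re_natB (k l : nat) : complex.Re (k%:R - l%:R : C) = k%:R - l%:R.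
Proof. by rewrite -!(rmorph_nat (real_complex R)) -rmorphB. Qed.

Lemma Im_natB (k l : nat) : complex.Im (k%:R - l%:R : C) = 0.
Proof. by rewrite -!(rmorph_nat (real_complex R)) -rmorphB. Qed.

Lemma modc_twist_root (k l : nat) (x : R) N (j : nat) : x <= 0 ->
  modc (Q k l (x%:C + root_arg R N j)) <= expR ((l%:R - k%:R) * x) * B.
Proof.
move=> x0; rewrite modcM modc_cexp opprB Re_cmulR ?Im_natB// Re_natB Re_root_arg.
rewrite ler_wpM2l ?expR_ge0// rhoB// modc_cexp Re_root_arg.
by rewrite -[leRHS](@expR0 R) ler_expR.
Qed.

Lemma avg_const N (c : C) : (0 < N)%N -> N%:R^-1 * \sum_(j < N) c = c.
Proof.
by move=> N0; rewrite sumr_const card_ord -[c *+ N]mulr_natl mulKf// pnatr_eq0 -lt0n.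
Qed.

Lemma avg0_bound (k l N : nat) : (0 < N)%N -> modc (avg N (Q k l) 0) <= B.
Proof.
move=> N0; apply: modc_mean => // j.
have := @modc_twist_root k l 0 N j (lexx 0).
by rewrite mulr0 expR0 mul1r.
Qed.

(** Near independence of Im y reduces [y] to its real part, and flatness moves it to 0. *)
Lemma avg_log k l (y : C) (e : R) : 0 < e -> exists N0, forall N, (N0 <= N)%N ->
  modc (avg N (Q k l) y - avg N (Q k l) 0) <= e.
Proof.
move=> e0; have e20 : 0 < e / 2 by rewrite divr_gt0.
have [d' d'0 Qd'] := @ucont_twist R rho urho (k%:R - l%:R) (modc y + 1 + 8) _ e20.
pose d := Num.min d' 1.
have d0 : 0 < d by rewrite lt_min d'0/=.
have [dd d1] : d <= d' /\ d <= 1 by rewrite /d !ge_min !lexx orbT.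
have [N1 N10 HN1] := exists_nat_inv_lt (pi *+ 2) d0.
have [N2 HN2] := flat_sym k l 0 (complex.Re y) e20.
exists (maxn N1 N2) => N; rewrite geq_max => /andP[N1N N2N].
have N0 : (0 < N)%N := leq_trans N10 N1N.
apply: (le_trans (modc_trans (avg N (Q k l) (complex.Re y)%:C) _ _)).
rewrite (splitr e) lerD//; last exact: HN2.
apply: (@avg_imag _ _ _ (modc y + 1) d) => //; first exact: twist_periodic.
- apply: avg_modulus => // u v ur vr uv; apply: Qd' => //; exact: le_trans uv dd.
- exact: HN1.
- by rewrite lerD2l.
Qed.

(** For mu = k - l < 0 the factor e^(-mu x) tends to 0 as x goes to minus infinity while [rho] stays
    bounded on the unit disc. The average is small at x = ln t for small t, and flatness carries
    this to 0. *)
Lemma avg_neg (k l : nat) (e : R) : (k < l)%N -> 0 < e ->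
  exists N0, forall N, (N0 <= N)%N -> modc (avg N (Q k l) 0) <= e.
Proof.
move=> kl e0; have e20 : 0 < e / 2 by rewrite divr_gt0.
have B1 : 0 < B + 1 by rewrite ltr_wpDl// disc_bound_ge0.
pose t := Num.min 1 (e / 2 / (B + 1)).
have t0 : 0 < t by rewrite lt_min ltr01 divr_gt0.
have [t1 tB] : t <= 1 /\ t <= e / 2 / (B + 1) by rewrite /t !ge_min !lexx orbT.
pose x := ln t; have x0 : x <= 0 by rewrite ln_le0.
have [N1 HN1] := flat_sym k l x 0 e20.
exists N1.+1 => N N1N; have N0 : (0 < N)%N by rewrite (leq_trans _ N1N).
apply: (le_trans (modc_le_add _ (avg N (Q k l) x%:C))).
rewrite (splitr e) lerD//; last by apply: HN1; exact: ltnW.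
apply: modc_mean => // j; apply: (le_trans (modc_twist_root _ _ _ _ x0)).
apply: (@le_trans _ _ (t * (B + 1))); last by rewrite -ler_pdivlMr.
rewrite ler_pM ?expR_ge0 ?disc_bound_ge0 ?lerDl// -[leRHS](lnK (x := t)) ?posrE// ler_expR -/x.
rewrite -[leRHS]mul1r; apply: ler_wnM2r => //.
by rewrite -natrB ?(ltnW kl)// ler1n subn_gt0.
Qed.

(** For mu = 0 the average at x = ln t is a mean of [rho] over a circle of radius t, close to
    [rho 0] by continuity. *)
Lemma avg_diag (k : nat) (e : R) : 0 < e ->
  exists N0, forall N, (N0 <= N)%N -> modc (avg N (Q k k) 0 - rho 0) <= e.
Proof.
move=> e0; have e20 : 0 < e / 2 by rewrite divr_gt0.
have [d d0 rd] := urho 1 e20.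
pose t := Num.min 1 d.
have t0 : 0 < t by rewrite lt_min ltr01.
have [t1 td] : t <= 1 /\ t <= d by rewrite /t !ge_min !lexx orbT.
pose x := ln t; have x0 : x <= 0 by rewrite ln_le0.
have [N1 HN1] := flat_sym k k x 0 e20.
exists N1.+1 => N N1N; have N0 : (0 < N)%N by rewrite (leq_trans _ N1N).
apply: (le_trans (modc_trans (avg N (Q k k) x%:C) _ _)).
rewrite (splitr e) lerD//; first by apply: HN1; exact: ltnW.
rewrite -[rho 0](avg_const (N := N))// /avg -mulrBr -sumrB.
apply: modc_mean => // j; rewrite /twist subrr oppr0 mul0r cexp0 mul1r.
have mt : modc (cexp (x%:C + root_arg R N j)) = t.
  by rewrite modc_cexp Re_root_arg lnK ?posrE.
by apply: rd; rewrite ?modc0 ?subr0 ?mt.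
Qed.

(** The terms of frequency k - l of a power series at z: none for negative frequency, [rho 0] for
    frequency 0, and a multiple of z^(k - l) otherwise. The multiple keeps its dependence on N, as
    its convergence is not known. *)
Definition lim_coef N (z : C) (k l : nat) : C :=
  if (k < l)%N then 0 else
  if k == l then rho 0 else z ^+ (k - l) * avg N (Q (k - l)%N 0%N) 0.

Lemma avg_lim_coef y z k l (e : R) : z = cexp y -> 0 < e ->
  exists N0, forall N, (N0 <= N)%N ->
  modc (cexp ((k%:R - l%:R) * y) * avg N (Q k l) y - lim_coef N z k l) <= e.
Proof.
move=> zE e0; set c := cexp _.
have c0 : 0 < modc c by rewrite modc_gt0// cexp_neq0.
have e20 : 0 < e / 2 by rewrite divr_gt0.
have e'0 : 0 < e / 2 / modc c by rewrite divr_gt0.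
have [N1 HN1] := avg_log k l y e'0.
suff [N2 HN2] : exists N0, forall N, (N0 <= N)%N ->
    modc (c * avg N (Q k l) 0 - lim_coef N z k l) <= e / 2.
  exists (maxn N1 N2) => N; rewrite geq_max => /andP[N1N N2N].
  apply: (le_trans (modc_trans (c * avg N (Q k l) 0) _ _)).
  rewrite (splitr e) lerD ?HN2// -mulrBr modcM mulrC -ler_pdivlMr//.
  exact: HN1.
rewrite /lim_coef; case: (ltngtP k l) => kl.
- have [N2 HN2] := avg_neg kl e'0; exists N2 => N /HN2 H.
  by rewrite subr0 modcM mulrC -ler_pdivlMr.
- exists 0%N => N _.
  have -> : k%:R - l%:R = (k - l)%:R - 0%:R :> C by rewrite natrB ?(ltnW kl)// subr0.
  rewrite /c natrB ?(ltnW kl)// -(natrB C (ltnW kl)) cexp_natM -zE subrr modc0.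
  exact: ltW.
- rewrite /c kl subrr mul0r cexp0.
  have [N2 HN2] := avg_diag l e20; exists N2 => N /HN2.
  by rewrite subrr mul1r.
Qed.

End Flat.

(** * Fejer means and first-order expansion at 0 *)

Section FlatDifferentiable.
Variable R : realType.
Local Notation C := R[i].
Variable rho : C -> C.
Hypothesis urho : ucont rho.
Variable B : R.
Hypothesis rhoB : forall z, modc z <= 1 -> modc (rho z) <= B.
Local Notation Q k l := (twist rho (k%:R - l%:R)).

(** The Cesaro mean of discrete Fourier sums on the circle through e^y is a convolution with the
    Fejer kernel: the factor e^((k - l) y) cancels against the twist and leaves the phase of the
    root. *)
Lemma fejer_avgE (M N : nat) y :
  M%:R^-1 * \sum_(k < M) \sum_(l < M) cexp ((k%:R - l%:R) * y) * avg N (Q k l) y =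
  \sum_(j < N) (fejer R N M j)%:C * rho (cexp (y + root_arg R N j)).
Proof.
under [RHS]eq_bigr do rewrite fejerE invfM [N%:R^-1 * _]mulrC -!mulrA.
rewrite -mulr_sumr; congr (_ * _).
under [RHS]eq_bigr do rewrite mulr_suml mulr_sumr.
rewrite [RHS]exchange_big/=; apply: eq_bigr => k _.
under [RHS]eq_bigr do rewrite mulr_suml mulr_sumr.
rewrite [RHS]exchange_big/=; apply: eq_bigr => l _.
rewrite /avg mulrCA mulr_sumr mulr_sumr; apply: eq_bigr => j _.
rewrite /twist; congr (_ * _); rewrite mulrA -cexpD; congr (cexp _ * _); ring.
Qed.

Lemma fejer_approx (e : R) : 0 < e -> exists2 M0, (0 < M0)%N &
  forall M N y, (M0 <= M)%N -> (M <= N)%N -> modc (cexp y) <= 1 ->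
  modc (M%:R^-1 * \sum_(k < M) \sum_(l < M)
    cexp ((k%:R - l%:R) * y) * avg N (Q k l) y - rho (cexp y)) <= e.
Proof.
move=> e0; have e20 : 0 < e / 2 by rewrite divr_gt0.
have B0 := disc_bound_ge0 rhoB.
have [d d0 rd] := urho 1 e20.
have [M0 M00 HM0] := exists_nat_inv_lt (8 * B / d ^+ 2) e20.
exists M0 => // M N y M0M MN yr.
have Mn : (0 < M)%N := leq_trans M00 M0M.
have Nn : (0 < N)%N := leq_trans Mn MN.
rewrite fejer_avgE.
have p0 (j : 'I_N) : 0 <= fejer R N M j by exact: fejer_ge0.
apply: (le_trans (modc_lincomb _ _ p0 (fejer_sum R Mn MN))).
(* Chebyshev's argument: if |u - 1| <= d, continuity gives e / 2; otherwise the trivial bound 2 B is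
   at most 2 B |u - 1|^2 / d^2. With variance at most 4 / M this produces 8 B / (d^2 M). *)
apply: (@le_trans _ _ (\sum_(j < N) (fejer R N M j * (e / 2) +
   2 * B / d ^+ 2 * (fejer R N M j * modc (cexp (root_arg R N j) - 1) ^+ 2)))).
  apply: ler_sum => j _.
  rewrite [X in _ <= _ + X]mulrCA -mulrDr ler_wpM2l ?fejer_ge0//.
  set u := cexp (root_arg R N j).
  have mu1 : modc u = 1 by rewrite modc_cexp -[X in complex.Re X]add0r (Re_root_arg _ _ 0) expR0.
  rewrite cexpD -/u.
  have mzu : modc (cexp y * u) <= 1 by rewrite modcM mu1 mulr1.
  have d20 : 0 < d ^+ 2 by rewrite exprn_gt0.
  have [ud|ud] := leP (modc (u - 1)) d.
    apply: ler_wpDr; first by rewrite mulr_ge0 ?exprn_ge0 ?modc_ge0// divr_ge0 ?(ltW d20)// mulr_ge0.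
    apply: rd => //; rewrite -[X in _ - X]mulr1 -mulrBr modcM (le_trans _ ud)//.
    by rewrite ler_piMl ?modc_ge0.
  apply: ler_wpDl; first exact: ltW.
  apply: (@le_trans _ _ (2 * B)).
    by rewrite (le_trans (modcB _ _))// mulr_natl mulr2n lerD// rhoB.
  rewrite mulrAC ler_pdivlMr// ler_wpM2l ?mulr_ge0//.
  by rewrite lerXn2r ?nnegrE ?modc_ge0 ?(ltW d0) ?(ltW ud).
rewrite big_split/= -[X in X + _]mulr_suml -[X in _ + X]mulr_sumr fejer_sum// mul1r.
rewrite [leRHS]splitr lerD2l.
apply: (le_trans _ (HM0 M M0M)).
apply: (@le_trans _ _ (2 * B / d ^+ 2 * (4 / M%:R))).
  by rewrite ler_wpM2l ?fejer_variance// divr_ge0 ?exprn_ge0 ?(ltW d0)// mulr_ge0.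
by rewrite le_eqVlt; apply/orP; left; apply/eqP; ring.
Qed.

Lemma uniform_eventually (M : nat) (P : nat -> nat -> Prop) :
  (forall k, exists N0, forall N, (N0 <= N)%N -> P k N) ->
  exists N0, forall N, (N0 <= N)%N -> forall k, (k < M)%N -> P k N.
Proof.
move=> H; elim: M => [|M [N1 HN1]]; first by exists 0%N.
have [N2 HN2] := H M; exists (maxn N1 N2) => N; rewrite geq_max => /andP[n1 n2] k.
by rewrite ltnS leq_eqVlt => /predU1P[->|kM]; [exact: HN2|exact: HN1].
Qed.

(** Entries with l > k vanish, and reversing l to k - l turns row k into the Taylor sum of degree
    k. *)
Lemma lim_coef_row N z M k : (k < M)%N ->
  \sum_(l < M) lim_coef rho N z k l = \sum_(d < k.+1) lim_coef rho N z d 0.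
Proof.
move=> kM; rewrite (bigID (fun l : 'I_M => (l < k.+1)%N))/= [X in _ + X]big1 ?addr0; last first.
  by move=> l; rewrite -leqNgt => kl; rewrite /lim_coef kl.
rewrite -(big_ord_widen M (fun l => lim_coef rho N z k l) kM).
rewrite (reindex_inj rev_ord_inj)/=; apply: eq_bigr => d _.
have dk : (d <= k)%N by rewrite -ltnS.
rewrite subSS /lim_coef ltnNge leq_subr/= subKn// subn0.
case: (posnP d) => [->|d0]; first by rewrite subn0 eqxx.
by rewrite gtn_eqF// ltn_subrL d0 (leq_trans d0).
Qed.

(** The terms of degree at least 2 have coefficients bounded by B, and a geometric series of ratio
    at most 1/2 sums them to 2 B |z|^2. Row 0 has no linear term, whence the indicator of 0 < k. *)
Lemma lim_coef_row_bound N z k : (0 < N)%N -> modc z <= 2^-1 ->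
  modc (\sum_(d < k.+1) lim_coef rho N z d 0 -
        (rho 0 + (0 < k)%N%:R * (z * avg N (Q 1%N 0%N) 0))) <= 2 * B * modc z ^+ 2.
Proof.
move=> N0 z2; have B0 := disc_bound_ge0 rhoB.
case: k => [|k].
  rewrite big_ord_recl big_ord0 addr0 /lim_coef/= mul0r addr0 subrr modc0.
  by rewrite mulr_ge0 ?exprn_ge0 ?modc_ge0 ?mulr_ge0.
rewrite !big_ord_recl /=; set S := \sum_(i < k) _.
rewrite [X in modc X](_ : _ = S); last by rewrite /lim_coef/=; ring.
apply: (le_trans (modc_sum _ _ _)).
apply: (@le_trans _ _ (\sum_(i < k) B * modc z ^+ 2 * 2^-1 ^+ i)).
  apply: ler_sum => i _; rewrite /lim_coef/= modcM modcX !subn0 /bump/= !add1n.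
  rewrite mulrC -mulrA ler_pM ?modc_ge0 ?exprn_ge0 ?avg0_bound//.
    by rewrite modc_ge0.
  rewrite -(addn2 i) addnC exprD ler_wpM2l ?exprn_ge0 ?modc_ge0//.
  by rewrite lerXn2r ?nnegrE ?modc_ge0 ?invr_ge0.
rewrite -mulr_sumr [leRHS](_ : _ = B * modc z ^+ 2 * 2); last by ring.
rewrite ler_wpM2l ?mulr_ge0 ?exprn_ge0 ?modc_ge0//.
have := subrX1 (2^-1 : R) k; have : 0 <= 2^-1 ^+ k :> R by rewrite exprn_ge0 ?invr_ge0.
by lra.
Qed.

(** All rows but row 0 contribute the linear term, so Cesaro averaging gives it the weight (M - 1) /
    M. *)
Lemma lim_coef_sum N z M : (0 < N)%N -> (0 < M)%N -> modc z <= 2^-1 ->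
  modc (M%:R^-1 * \sum_(k < M) \sum_(l < M) lim_coef rho N z k l -
    (rho 0 + M%:R^-1 * (M.-1)%:R * avg N (Q 1%N 0%N) 0 * z)) <= 2 * B * modc z ^+ 2.
Proof.
move=> N0 M0 z2.
have -> : rho 0 + M%:R^-1 * (M.-1)%:R * avg N (Q 1%N 0%N) 0 * z =
   M%:R^-1 * \sum_(k < M) (rho 0 + (0 < k)%N%:R * (z * avg N (Q 1%N 0%N) 0)).
  rewrite big_split/= mulrDr avg_const//; congr (_ + _).
  have -> : \sum_(k < M) (0 < k)%N%:R * (z * avg N (Q 1%N 0%N) 0) =
      (M.-1)%:R * (z * avg N (Q 1%N 0%N) 0).
    case: M M0 => // M _; rewrite big_ord_recl/= mul0r add0r.
    by rewrite sumr_const card_ord mul1r mulr_natl.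
  by ring.
rewrite -mulrBr -sumrB; apply: modc_mean => // k.
by rewrite lim_coef_row// lim_coef_row_bound.
Qed.

Hypothesis flat : forall (k l : nat) (x1 x2 e : R), x1 < x2 -> 0 < e ->
  exists N0, forall N, (N0 <= N)%N ->
    modc (avg N (Q k l) x2%:C - avg N (Q k l) x1%:C) <= e.

(** The linear coefficient varies with M and N but not with z, so two points can be compared at
    common M and N. N is taken large after M, since M^2 coefficients must be close to their limiting
    form simultaneously. *)
Lemma flat_expansion z (e : R) : z != 0 -> modc z <= 2^-1 -> 0 < e ->
  exists2 M0, (0 < M0)%N & forall M, (M0 <= M)%N -> exists N0, forall N, (N0 <= N)%N ->
    modc (rho z - (rho 0 + M%:R^-1 * (M.-1)%:R * avg N (Q 1%N 0%N) 0 * z)) <=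
    2 * B * modc z ^+ 2 + e.
Proof.
move=> z0 z2 e0; have e20 : 0 < e / 2 by rewrite divr_gt0.
have [y yz] := cexp_surj z0.
have [M0 M00 HM0] := fejer_approx e20.
exists M0 => // M M0M; have Mn : (0 < M)%N := leq_trans M00 M0M.
have MR : 0 < M%:R :> R by rewrite ltr0n.
have e'0 : 0 < e / 2 / M%:R by rewrite divr_gt0.
have [N1 HN1] := @uniform_eventually M (fun k N => forall l, (l < M)%N ->
    modc (cexp ((k%:R - l%:R) * y) * avg N (Q k l) y - lim_coef rho N z k l) <= e / 2 / M%:R)
  (fun k => @uniform_eventually M _ (fun l =>
    avg_lim_coef urho rhoB flat k l (esym yz) e'0)).
exists (maxn M N1) => N; rewrite geq_max => /andP[MN N1N].
have Nn : (0 < N)%N := leq_trans Mn MN.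
have z1 : modc (cexp y) <= 1 by rewrite yz; lra.
have := HM0 M N y M0M MN z1; rewrite yz; set S1 := _ * \sum_k _ => HS.
have := lim_coef_sum Nn Mn z2; set S2 := _ * \sum_k _ => HS2.
have S12 : modc (S1 - S2) <= e / 2.
  rewrite /S1 /S2 -mulrBr -sumrB; apply: modc_mean => // k.
  rewrite -sumrB (le_trans (modc_sum_le (e := e / 2 / M%:R) _))//.
    by move=> l; exact: HN1.
  by rewrite card_ord mulrC divfK// lt0r_neq0.
set T := rho 0 + _.
have := modc_trans S1 (rho z) T; have := modc_trans S2 S1 T.
by rewrite (modc_sym (rho z) S1); lra.
Qed.

End FlatDifferentiable.

(** * The dichotomy between oscillation and differentiability at 0 *)

Section ConjugationTheorem.
Variable R : realType.
Local Notation C := R[i].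

Definition eps_rdiff (f : C -> C) (z0 : C) := exists dx dy : C,
  forall e : R, 0 < e -> exists2 d : R, 0 < d & forall h, modc h <= d ->
    modc (f (z0 + h) - f z0 - dx * (complex.Re h)%:C - dy * (complex.Im h)%:C)
    <= e * modc h.

(** The intervals [g t - a t, g t + a t] meet pairwise, so they have a common point, the supremum of
    their left ends. It replaces a limit of difference quotients. *)
Lemma sup_squeeze (T : Type) (S : set T) (g a : T -> R) (t0 : T) : S t0 ->
  (forall s t, S s -> S t -> `|g s - g t| <= a s + a t) ->
  exists c, forall t, S t -> `|g t - c| <= a t.
Proof.
move=> St0 gS; pose E := [set g t - a t | t in S].
have ub t : S t -> ubound E (g t + a t).
  by move=> St _ [s Ss <-]; have := gS s t Ss St; rewrite ler_norml; lra.
have E0 : E (g t0 - a t0) by exists t0.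
exists (sup E) => t St.
have h1 : sup E <= g t + a t by apply: ge_sup; [exists (g t0 - a t0) | exact: ub].
have h2 : g t - a t <= sup E.
  by apply: ub_le_sup; [exists (g t0 + a t0); exact: ub|exists t].
by rewrite ler_norml; lra.
Qed.

Lemma ReB (x y : C) : complex.Re (x - y) = complex.Re x - complex.Re y.
Proof. by case: x; case: y. Qed.

Lemma ImB (x y : C) : complex.Im (x - y) = complex.Im x - complex.Im y.
Proof. by case: x; case: y. Qed.

(** The difference quotients at 0 satisfy a Cauchy condition, so real and imaginary parts each have
    a limit; f is even complex differentiable there, with partial derivatives c and i c. *)
Lemma lipschitz_quotient_rdiff (f : C -> C) (A : R) : 0 <= A ->
  (forall z1 z2, z1 != 0 -> z2 != 0 -> modc z1 <= 2^-1 -> modc z2 <= 2^-1 ->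
    modc ((f z1 - f 0) / z1 - (f z2 - f 0) / z2) <= A * modc z1 + A * modc z2) ->
  eps_rdiff f 0.
Proof.
move=> A0 H; pose S := [set z : C | z != 0 /\ modc z <= 2^-1].
pose q z := (f z - f 0) / z.
have S0 : S (2^-1)%:C.
  split; last by rewrite modcR ger0_norm ?invr_ge0.
  by rewrite -(rmorph0 (real_complex R)) (inj_eq (@complexI R)) invr_eq0.
have [a Ha] : exists c, forall z, S z -> `|complex.Re (q z) - c| <= A * modc z.
  apply: (sup_squeeze S0) => s t [s0 sr] [t0 tr].
  by apply: le_trans (H s t s0 t0 sr tr); rewrite -ReB modc_Re.
have [b Hb] : exists c, forall z, S z -> `|complex.Im (q z) - c| <= A * modc z.
  apply: (sup_squeeze S0) => s t [s0 sr] [t0 tr].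
  by apply: le_trans (H s t s0 t0 sr tr); rewrite -ImB modc_Im.
pose c := a +i* b; exists c, (c * 'i%C) => e e0.
have A1 : 0 < 2 * A + 1 by rewrite ltr_wpDl// mulr_ge0.
exists (Num.min 2^-1 (e / (2 * A + 1))).
  by rewrite lt_min divr_gt0// andbT invr_gt0.
move=> h; rewrite le_min add0r => /andP[h2 hA].
have [->|h0] := eqVneq h 0; first by rewrite subrr rmorph0 !mulr0 !subr0 modc0 mulr0.
have Sh : S h by [].
have -> : f h - f 0 - c * (complex.Re h)%:C - c * 'i%C * (complex.Im h)%:C =
    (q h - c) * h.
  rewrite mulrBl /q divfK// [X in _ = _ - c * X](complexE h); ring.
rewrite modcM ler_wpM2r ?modc_ge0//.
rewrite (le_trans (modc_ReIm _))// ReB ImB.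
have := Ha h Sh; have := Hb h Sh; rewrite /= => hb ha.
apply: (@le_trans _ _ ((2 * A + 1) * modc h)).
  by have := modc_ge0 h; lra.
by rewrite mulrC -ler_pdivlMr.
Qed.

Theorem conj_in_span (rho : C -> C) : ucont rho -> ~ eps_rdiff rho 0 ->
  forall r, closed_span [set z | modc z <= r] (exp_chains rho) (fun z => z^*).
Proof.
move=> urho ndiff r.
have [[k [l [x1 [x2 [e [x12 e0 osc]]]]]]|nosc] := pselect
  (exists (k l : nat) (x1 x2 e : R), [/\ x1 < x2, 0 < e &
     oscillates (fun N => avg N (twist rho (k%:R - l%:R))) x1 x2 e]).
  by apply: (oscillates_conj urho (mu := k%:R - l%:R) _ x12 e0 osc); exact: twist_periodic.
exfalso; apply: ndiff.
have flat : forall (k l : nat) (x1 x2 e : R), x1 < x2 -> 0 < e ->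
  exists N0, forall N, (N0 <= N)%N ->
    modc (avg N (twist rho (k%:R - l%:R)) x2%:C -
          avg N (twist rho (k%:R - l%:R)) x1%:C) <= e.
  move=> k l x1 x2 e x12 e0; apply: contrapT => H; apply: nosc.
  exists k, l, x1, x2, e; split=> // N0.
  apply: contrapT => H'; apply: H; exists N0 => N N0N.
  by rewrite leNgt; apply/negP => /ltW h; apply: H'; exists N.
have [B B0 rhoB] := ucont_bounded urho 1.
apply: (@lipschitz_quotient_rdiff rho (2 * B)); first by rewrite mulr_ge0.
move=> z1 z2 z10 z20 z1r z2r.
apply/ler_addgt0Pl => e e0.
have m1 := modc_gt0 z10; have m2 := modc_gt0 z20.
have e10 : 0 < e / 2 * modc z1 by rewrite mulr_gt0// divr_gt0.
have e20 : 0 < e / 2 * modc z2 by rewrite mulr_gt0// divr_gt0.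
have [M1 M10 H1] := flat_expansion urho rhoB flat z10 z1r e10.
have [M2 M20 H2] := flat_expansion urho rhoB flat z20 z2r e20.
(* Both expansions are read at the same M and N, so the linear coefficient [c] is common and
   disappears when the two quotients are compared. *)
have [N1 {}H1] := H1 (maxn M1 M2) (leq_maxl _ _).
have [N2 {}H2] := H2 (maxn M1 M2) (leq_maxr _ _).
have {}H1 := H1 (maxn N1 N2) (leq_maxl _ _).
have {}H2 := H2 (maxn N1 N2) (leq_maxr _ _).
move: H1 H2; set c := _ * avg _ _ _ => H1 H2.
have Hq z (e' : R) : z != 0 ->
    modc (rho z - (rho 0 + c * z)) <= 2 * B * modc z ^+ 2 + e' * modc z ->
    modc ((rho z - rho 0) / z - c) <= 2 * B * modc z + e'.
  move=> z0; have mz := modc_gt0 z0.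
  have -> : (rho z - rho 0) / z - c = (rho z - (rho 0 + c * z)) / z by field.
  rewrite modcM modcV ler_pdivrMr// => h; apply: (le_trans h).
  by rewrite le_eqVlt; apply/orP; left; apply/eqP; ring.
have := Hq _ _ z10 H1; have := Hq _ _ z20 H2.
have := modc_trans c ((rho z1 - rho 0) / z1) ((rho z2 - rho 0) / z2).
by rewrite (modc_sym c); lra.
Qed.

End ConjugationTheorem.

(** * Networks as register machines *)

Section Registers.
Variables (R : realType) (rho : R[i] -> R[i]) (n m : nat).
Local Notation C := R[i].
Local Notation W := (n + m + 1)%N.
Variable D : set 'cV[C]_n.

Definition vdist_le k (u v : 'cV[C]_k) (e : R) :=
  forall i, modc (u i 0 - v i 0) <= e.

Lemma vdist_affine k l (A : 'M[C]_(l, k)) : exists2 L : R, 0 < L &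
  forall (b : 'cV[C]_l) (u v : 'cV[C]_k) (e : R), 0 <= e ->
    vdist_le u v e ->
    vdist_le (A *m u + b) (A *m v + b) (L * e).
Proof.
pose L := \sum_i \sum_j modc (A i j) + 1.
have S0 i : 0 <= \sum_j modc (A i j) by rewrite sumr_ge0// => j _; exact: modc_ge0.
exists L; first by rewrite ltr_wpDl// sumr_ge0.
move=> b u v e e0 uv i.
have -> : (A *m u + b) i 0 - (A *m v + b) i 0 = \sum_j A i j * (u j 0 - v j 0).
  rewrite !mxE opprD addrACA subrr addr0 -sumrB.
  by apply: eq_bigr => j _; rewrite mulrBr.
apply: (le_trans (modc_sum _ _ _)).
apply: (@le_trans _ _ ((\sum_j modc (A i j)) * e)).
  by rewrite mulr_suml ler_sum// => j _; rewrite modcM ler_wpM2l ?modc_ge0.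
rewrite ler_wpM2r// /L (bigD1 i)//= -addrA lerDl addr_ge0// sumr_ge0//.
Qed.

(** States just before an activation, so that a further affine map can be merged into the last layer
    at no cost in depth. *)
Definition hidden_states : set ('cV[C]_n -> 'cV[C]_W) :=
  [set f | exists (k : nat) (A1 : 'M[C]_(W, n)) (b1 : 'cV[C]_W)
             (As : nat -> 'M[C]_W) (bs : nat -> 'cV[C]_W),
     forall z, f z = hidden rho As bs k (A1 *m z + b1)].

Lemma hidden_ext (As As' : nat -> 'M[C]_W) bs bs' k x :
  (forall j, (j < k)%N -> As j = As' j /\ bs j = bs' j) ->
  hidden rho As bs k x = hidden rho As' bs' k x.
Proof.
elim: k => [//|k IH] H /=; have [-> ->] := H k (ltnSn k).
by rewrite IH// => j jk; apply: H; rewrite ltnW.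
Qed.

Lemma hidden_step f A b : hidden_states f ->
  hidden_states (fun z => A *m act rho (f z) + b).
Proof.
move=> [k [A1 [b1 [As [bs fE]]]]].
exists k.+1, A1, b1, (fun j => if j == k then A else As j),
  (fun j => if j == k then b else bs j) => z /=.
rewrite eqxx fE; congr (_ *m act _ _ + _).
by apply: hidden_ext => j jk; rewrite ltn_eqF.
Qed.

Lemma hidden_affine f A b : hidden_states f ->
  hidden_states (fun z => A *m f z + b).
Proof.
move=> [[|k] [A1 [b1 [As [bs fE]]]]].
  exists 0%N, (A *m A1), (A *m b1 + b), As, bs => z /=.
  by rewrite fE/= mulmxDr mulmxA addrA.
pose As' j := if j == k then A *m As k else As j.
pose bs' j := if j == k then A *m bs k + b else bs j.
exists k.+1, A1, b1, As', bs' => z /=.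
rewrite fE/= -(@hidden_ext As As' bs bs'); last first.
  by move=> j jk; rewrite /As' /bs' ltn_eqF.
by rewrite /As' /bs' eqxx mulmxDr mulmxA addrA.
Qed.

Definition reach : set ('cV[C]_n -> 'cV[C]_W) :=
  [set f | forall e : R, 0 < e -> exists2 g, hidden_states g &
    forall z, D z -> vdist_le (g z) (f z) e].

Lemma reach_affine f A b : reach f -> reach (fun z => A *m f z + b).
Proof.
move=> rf e e0; have [L L0 HL] := vdist_affine A.
have [g gH gf] := rf _ (divr_gt0 e0 L0).
exists (fun z => A *m g z + b); first exact: hidden_affine.
move=> z Dz; rewrite -[e](divfK (lt0r_neq0 L0)) mulrC; apply: HL; last exact: gf.
by rewrite divr_ge0 ?(ltW e0) ?(ltW L0).
Qed.

Lemma reach_ext f g : (forall z, D z -> f z = g z) -> reach f -> reach g.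
Proof.
move=> fg rf e e0; have [h hH hf] := rf e e0; exists h => // z Dz.
by rewrite -fg//; exact: hf.
Qed.

(** The scalar affine maps around [rho] are absorbed into the adjacent layers, so [phi] can stand
    for [rho] in any single register without extra width. *)
Definition neuron (phi : C -> C) := forall r e : R, 0 < e ->
  exists a c d b : C, forall x, modc x <= r ->
    modc (a * rho (c * x + d) + b - phi x) <= e.

Definition bounded_vec k (f : 'cV[C]_n -> 'cV[C]_k) :=
  exists r : R, forall z, D z -> forall i, modc (f z i 0) <= r.

Definition last_id (phi : C -> C) (v : 'cV[C]_W) : 'cV[C]_W :=
  \col_i (if i == rshift (n + m) 0 then phi (v i 0) else v i 0).

Lemma diag_mul_col k (d v : 'cV[C]_k) (b : 'cV[C]_k) i :
  (diag_mx d^T *m v + b) i 0 = d i 0 * v i 0 + b i 0.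
Proof. by rewrite mxE mul_diag_mx !mxE. Qed.

(** Every register passes through the activation, so those to be preserved use the neuron for the
    identity while the last one uses the neuron for [phi]. *)
Lemma reach_last_id f phi : neuron id -> neuron phi -> ucont phi ->
  bounded_vec f -> reach f -> reach (fun z => last_id phi (f z)).
Proof.
move=> nid nphi uphi [r fr] rf e e0.
have e20 : 0 < e / 2 by rewrite divr_gt0.
have [d' d'0 Hd'] := uphi (r + 1) _ e20.
(* [d'] serves the continuity of [phi], 1 keeps the approximate values in the disc of radius
   [r + 1], and [e / 2] is the error of the preserved registers. *)
pose d := Num.min d' (Num.min 1 (e / 2)).
have d0 : 0 < d by rewrite !lt_min d'0 e20/= ltr01.
have [dd' [d1 de]] : d <= d' /\ d <= 1 /\ d <= e / 2.
  by rewrite /d !ge_min !lexx !orbT.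
have [g gH gf] := rf d d0.
have [a1 [c1 [q1 [b1 H1]]]] := nid (r + 1) _ e20.
have [a2 [c2 [q2 [b2 H2]]]] := nphi (r + 1) _ e20.
pose sel (x y : C) : 'cV[C]_W := \col_i (if i == rshift (n + m) 0 then y else x).
exists (fun z => diag_mx (sel a1 a2)^T *m
   act rho (diag_mx (sel c1 c2)^T *m g z + sel q1 q2) + sel b1 b2).
  exact/hidden_step/hidden_affine.
move=> z Dz i; rewrite diag_mul_col /act [map_mx _ _ _ _]mxE diag_mul_col !mxE.
have gfi := gf z Dz i; have fri := fr z Dz i.
have gr : modc (g z i 0) <= r + 1.
  by rewrite (le_trans (modc_le_add _ (f z i 0)))// lerD// (le_trans gfi).
case: ifP => _.
  apply: (le_trans (modc_trans (phi (g z i 0)) _ _)).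
  rewrite (splitr e) lerD ?H2// Hd'//; last exact: le_trans gfi dd'.
  by rewrite (le_trans fri)// lerDl.
apply: (le_trans (modc_trans (g z i 0) _ _)).
by rewrite (splitr e) lerD ?H1// (le_trans gfi).
Qed.

Definition state (z : 'cV[C]_n) (o : 'cV[C]_m) (s : C) : 'cV[C]_W :=
  col_mx (col_mx z o) s%:M.

Lemma last_id_state phi z o s : last_id phi (state z o s) = state z o (phi s).
Proof.
apply/colP => i; rewrite mxE /state; case: (splitP i) => j ij.
  have -> : i = lshift 1 j by exact/val_inj.
  by rewrite eq_lrshift !col_mxEu.
have -> : i = rshift (n + m) j by exact/val_inj.
by rewrite ord1 eqxx !col_mxEd !mxE.
Qed.

Definition linform (b : 'rV[C]_n) (z : 'cV[C]_n) : C := (b *m z) 0 0.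

Lemma mx11_linform b z : b *m z = (linform b z)%:M.
Proof. exact: mx11_scalar. Qed.

Lemma scratch_affine a b c z o s :
  block_mx 1%:M 0 (row_mx b 0) a%:M *m state z o s + col_mx 0 c%:M =
  state z o (a * s + linform b z + c).
Proof.
rewrite /state mul_block_col mul1mx mul0mx addr0 mul_row_col mul0mx addr0.
rewrite add_col_mx addr0 mx11_linform -scalar_mxM -!raddfD/=.
by congr (col_mx _ _%:M); ring.
Qed.

(** The scratch register is emptied in the same step, so that the next chain can start from 0. *)
Lemma add_output_affine c z o s :
  block_mx 1%:M (col_mx 0 c) 0 0 *m state z o s + 0 = state z (o + s *: c) 0.
Proof.
rewrite addr0 /state mul_block_col mul1mx !mul0mx addr0 mul_col_mx mul0mx.
rewrite add_col_mx addr0 raddf0 mul_mx_scalar//.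
Qed.

Hypothesis Dbounded : exists r : R, forall z, D z -> forall i, modc (z i 0) <= r.
Hypothesis neuron_id : neuron id.

Definition outputs : set ('cV[C]_n -> 'cV[C]_m) :=
  [set o | bounded_vec o /\ reach (fun z => state z (o z) 0)].

(** Quantified over every accumulated output: the computation of [s] must preserve whatever is
    already stored. *)
Definition scratch : set ('cV[C]_n -> C) :=
  [set s | bounded_on (R := R) D s /\
    forall o, outputs o -> reach (fun z => state z (o z) (s z))].

Lemma bounded_linform b : bounded_on (R := R) D (linform b).
Proof.
have [r Hr] := Dbounded; exists ((\sum_j modc (b 0 j)) * r) => z Dz.
rewrite /linform mxE (le_trans (modc_sum _ _ _))// mulr_suml ler_sum// => j _.
by rewrite modcM ler_wpM2l ?modc_ge0// Hr.
Qed.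

Lemma bounded_ucont phi s : ucont phi -> bounded_on (R := R) D s ->
  bounded_on (R := R) D (fun z => phi (s z)).
Proof.
move=> uphi [r sr]; have [B B0 HB] := ucont_bounded uphi r.
by exists B => z Dz; apply: HB; exact: sr.
Qed.

Lemma bounded_state o s : bounded_vec o -> bounded_on (R := R) D s ->
  bounded_vec (fun z => state z (o z) (s z)).
Proof.
move=> [ro Ho] [rs Hs]; have [r Hr] := Dbounded.
exists (Num.max r (Num.max ro rs)) => z Dz i; rewrite /state.
case: (splitP i) => j ij; last first.
  have -> : i = rshift (n + m) j by exact/val_inj.
  by rewrite col_mxEd !mxE ord1 !le_max Hs// !orbT.
have -> : i = lshift 1 j by exact/val_inj.
rewrite col_mxEu; case: (splitP j) => l jl.
  have -> : j = lshift m l by exact/val_inj.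
  by rewrite col_mxEu !le_max Hr.
have -> : j = rshift n l by exact/val_inj.
by rewrite col_mxEd !le_max Ho// orbT.
Qed.

Lemma scratch0 : scratch (fun=> 0).
Proof. by split; [exists 0 => z _; rewrite modc0 | move=> o []]. Qed.

Lemma bounded_affine a b c s : bounded_on (R := R) D s ->
  bounded_on (R := R) D (fun z => a * s z + linform b z + c).
Proof.
move=> bs; have HB := bounded_subspace R D.
apply: (subspaceD HB); last by exists (modc c) => z _.
by apply: (subspaceD HB); [exact: (subspaceZ HB)|exact: bounded_linform].
Qed.

Lemma scratch_step phi a b c s : neuron phi -> ucont phi -> scratch s ->
  scratch (fun z => phi (a * s z + linform b z + c)).
Proof.
move=> nphi uphi [bs Hs].
have bs' := bounded_affine a b c bs.
split; first exact: bounded_ucont.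
move=> o Oo; have [bo _] := Oo.
have H : reach (fun z => state z (o z) (a * s z + linform b z + c)).
  apply: reach_ext (reach_affine (block_mx 1%:M 0 (row_mx b 0) a%:M) (col_mx 0 c%:M) (Hs o Oo)) => z _.
  exact: scratch_affine.
apply: reach_ext (reach_last_id neuron_id nphi uphi (bounded_state bo bs') H) => z _.
by rewrite last_id_state.
Qed.

(** Formulated as an operation on arbitrary outputs in an arbitrary direction [c], so that sums are
    obtained by running networks one after the other and scalar factors are absorbed in [c]. *)
Definition addable : set ('cV[C]_n -> C) :=
  [set f | bounded_on (R := R) D f /\ forall o (c : 'cV[C]_m), outputs o ->
    outputs (fun z => o z + f z *: c)].

Lemma outputs_ext o ob : (forall z, D z -> o z = ob z) -> outputs o -> outputs ob.
Proof.
move=> eqo [[r Hr] ro]; split.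
  by exists r => z Dz i; rewrite -eqo// Hr.
by apply: reach_ext ro => z Dz; rewrite eqo.
Qed.

Lemma vdist_state z (o ob : 'cV[C]_m) (e : R) : 0 <= e -> vdist_le o ob e ->
  vdist_le (state z o 0) (state z ob 0) e.
Proof.
move=> e0 eqo i; rewrite /state; case: (splitP i) => j ij; last first.
  have -> : i = rshift (n + m) j by exact/val_inj.
  by rewrite !col_mxEd subrr modc0.
have -> : i = lshift 1 j by exact/val_inj.
rewrite !col_mxEu; case: (splitP j) => l jl.
  have -> : j = lshift m l by exact/val_inj.
  by rewrite !col_mxEu subrr modc0.
have -> : j = rshift n l by exact/val_inj.
by rewrite !col_mxEd.
Qed.

Lemma outputs_lim o : (forall e : R, 0 < e -> exists2 ob, outputs ob &
    forall z, D z -> vdist_le (ob z) (o z) e) -> outputs o.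
Proof.
move=> H; split.
  have [ob [[r Hr] _] obo] := H 1 ltr01; exists (r + 1) => z Dz i.
  rewrite (le_trans (modc_le_add _ (ob z i 0)))// lerD ?Hr// modc_sym.
  exact: obo.
move=> e e0; have e20 : 0 < e / 2 by rewrite divr_gt0.
have [ob [_ ro'] obo] := H _ e20.
have [g gH go'] := ro' _ e20; exists g => // z Dz i.
apply: (le_trans (modc_trans (state z (ob z) 0 i 0) _ _)).
rewrite (splitr e) lerD//; first exact: go'.
by apply: vdist_state; [exact: ltW|exact: obo].
Qed.

Lemma scratch_addable : scratch `<=` addable.
Proof.
move=> s [bs Hs]; split=> // o c Oo; have [[r Hr] _] := Oo; split.
  have [rs Hrs] := bs.
  exists (r + rs * \sum_i modc (c i 0)) => z Dz i; rewrite !mxE.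
  rewrite (le_trans (modcD _ _))// lerD ?Hr// modcM ler_pM ?modc_ge0 ?Hrs//.
  by rewrite (bigD1 i)//= lerDl sumr_ge0// => j _; exact: modc_ge0.
apply: reach_ext (reach_affine (block_mx 1%:M (col_mx 0 c) 0 0) 0 (Hs o Oo)) => z _.
exact: add_output_affine.
Qed.

Lemma addable_subspace : closed_subspace D addable.
Proof.
have HB := bounded_subspace R D.
split.
- exact/scratch_addable/scratch0.
- move=> f g k [bf Hf] [bg Hg]; split; first exact: (subspaceDZ HB).
  move=> o c Oo; apply: outputs_ext (Hg _ (k *: c) (Hf o c Oo)) => z _.
  by rewrite scalerDl addrA scalerA [g z * k]mulrC.
- move=> f fV; split.
    by apply: (subspace_lim HB) => e /fV [g [bg _] gf]; exists g.
  move=> o c Oo; apply: outputs_lim => e e0.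
  have c0 : 0 < \sum_i modc (c i 0) + 1.
    by rewrite ltr_wpDl// sumr_ge0// => i _; exact: modc_ge0.
  have [g [_ Hg] gf] := fV _ (divr_gt0 e0 c0).
  exists (fun z => o z + g z *: c); first exact: Hg.
  move=> z Dz i; rewrite !mxE opprD addrACA subrr add0r -mulrBl modcM.
  rewrite -[e](divfK (lt0r_neq0 c0)) ler_pM ?modc_ge0 ?gf//.
  rewrite (bigD1 i)//= -addrA lerDl addr_ge0// sumr_ge0// => j _; exact: modc_ge0.
Qed.

Lemma outputs0 : outputs (fun=> 0).
Proof.
split; first by exists 0 => z _ i; rewrite mxE modc0.
move=> e e0; exists (fun z => state z 0 0); last first.
  by move=> z _ i; rewrite subrr modc0 ltW.
exists 0%N, (col_mx (col_mx 1%:M 0) 0), 0, (fun=> 0), (fun=> 0) => z /=.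
by rewrite addr0 !mul_col_mx mul1mx !mul0mx /state raddf0.
Qed.

Lemma addable_outputs (g : 'cV[C]_n -> 'cV[C]_m) :
  (forall i, addable (fun z => g z i 0)) -> outputs g.
Proof.
move=> Vg.
have H (s : seq 'I_m) : outputs (fun z => \sum_(i <- s) g z i 0 *: delta_mx i 0).
  elim: s => [|i s IH].
    by apply: outputs_ext outputs0 => z _; rewrite big_nil.
  apply: outputs_ext ((Vg i).2 _ (delta_mx i 0) IH) => z _.
  by rewrite big_cons addrC.
apply: outputs_ext (H (index_enum _)) => z _; apply/colP => i.
rewrite summxE (bigD1 i)//= big1 ?addr0; last first.
  by move=> j ji; rewrite !mxE eq_sym (negbTE ji) mulr0.
by rewrite !mxE !eqxx mulr1.
Qed.

(** A network applies one more activation before its output layer; the neuron for the identity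
    neutralises it, and its outer affine map is merged with the projection to the output
    registers. *)
Lemma outputs_NN o (e : R) : outputs o -> 0 < e ->
  exists2 f, NN rho n m W f & forall z, D z -> vdist_le (f z) (o z) e.
Proof.
move=> [[r Hr] ro] e0; have e20 : 0 < e / 2 by rewrite divr_gt0.
pose d := Num.min 1 (e / 2).
have d0 : 0 < d by rewrite lt_min e20/= ltr01.
have [d1 de] : d <= 1 /\ d <= e / 2 by rewrite /d !ge_min !lexx !orbT.
have [g gH go] := ro d d0.
have [a [c [q [b H]]]] := neuron_id (r + 1) e20.
have [k [A1 [b1 [As [bs gE]]]]] :=
  hidden_affine c%:M (const_mx q) gH.
pose P : 'M[C]_(m, W) := row_mx (row_mx 0 1%:M) 0.
exists (fun z => (a *: P) *m act rho (c%:M *m g z + const_mx q) + const_mx b).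
  exists k, A1, b1, As, bs, (a *: P), (const_mx b).
  by apply/funext => z; rewrite gE.
have PE (v : 'cV[C]_W) i : (P *m v) i 0 = v (lshift 1 (rshift n i)) 0.
  rewrite -[v]vsubmxK -[usubmx v]vsubmxK !mul_row_col !mul0mx add0r addr0 mul1mx.
  by rewrite col_mxEu col_mxEd.
move=> z Dz i; rewrite mxE -scalemxAl mxE PE mul_scalar_mx !mxE.
set l := lshift _ _.
have := go z Dz l; rewrite /state col_mxEu col_mxEd => gl.
apply: (le_trans (modc_trans (g z l 0) _ _)).
rewrite (splitr e) lerD//; last exact: le_trans gl de.
apply: H; rewrite (le_trans (modc_le_add _ (o z i 0)))// lerD ?Hr//.
exact: le_trans gl d1.
Qed.

End Registers.

(** * Functions computed by one neuron *)

Section Neurons.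
Variable R : realType.
Local Notation C := R[i].
Implicit Types (rho phi psi : C -> C).

Lemma neuron_self rho : neuron rho rho.
Proof.
move=> r e e0; exists 1, 1, 0, 0 => x _.
by rewrite !mul1r !addr0 subrr modc0 ltW.
Qed.

Lemma neuron_trans rho phi psi : neuron rho phi -> neuron phi psi -> neuron rho psi.
Proof.
move=> H1 H2 r e e0; have e20 : 0 < e / 2 by rewrite divr_gt0.
have [a [c [d [b Hp]]]] := H2 r _ e20.
have a0 : 0 < modc a + 1 by rewrite ltr_wpDl ?modc_ge0.
have [a' [c' [d' [b' Hr]]]] := H1 (modc c * r + modc d) _ (divr_gt0 e20 a0).
exists (a * a'), (c' * c), (c' * d + d'), (a * b' + b) => x xr.
apply: (le_trans (modc_trans (a * phi (c * x + d) + b) _ _)).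
rewrite (splitr e) lerD ?Hp//.
rewrite [X in modc X](_ : _ = a * (a' * rho (c' * (c * x + d) + d') + b' - phi (c * x + d))); last first.
  rewrite (_ : c' * c * x + (c' * d + d') = c' * (c * x + d) + d'); ring.
rewrite modcM -[leRHS](divfK (lt0r_neq0 a0)) mulrC ler_pM ?modc_ge0// ?lerDl//.
apply: Hr; rewrite (le_trans (modcD _ _))// lerD// modcM ler_wpM2l ?modc_ge0//.
Qed.

(** The difference quotient (e^(h x) - 1) / h for small h. *)
Lemma neuron_cexp_id : neuron (@cexp R) id.
Proof.
move=> r e e0; have r0 : 0 < `|r| + 1 by rewrite ltr_wpDl.
have [d d0 H] := cexp_diff0 (divr_gt0 e0 r0).
pose h := d / (`|r| + 1); have h0 : 0 < h by rewrite divr_gt0.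
have hC0 : h%:C != 0 :> C.
  by rewrite -(rmorph0 (real_complex R)) (inj_eq (@complexI R)) lt0r_neq0.
exists (h^-1%:C), h%:C, 0, (- h^-1%:C) => x xr; rewrite addr0.
have xr' : modc x <= `|r| + 1.
  by rewrite (le_trans xr)// (le_trans (ler_norm _))// lerDl.
have hx : modc (h%:C * x) <= d.
  by rewrite modcM modcR (gtr0_norm h0) -[leRHS](divfK (lt0r_neq0 r0)) ler_wpM2l// ltW.
rewrite [X in modc X](_ : _ = h^-1%:C * (cexp (h%:C * x) - 1 - h%:C * x)); last first.
  by rewrite fmorphV/=; field; exact: hC0.
rewrite modcM modcR gtr0_norm ?invr_gt0// ler_pdivrMl//.
apply: (le_trans (H _ hx)); rewrite modcM modcR (gtr0_norm h0) mulrCA ler_wpM2l ?(ltW h0)//.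
by rewrite -[leRHS](divfK (lt0r_neq0 r0)) ler_wpM2l// divr_ge0 ?(ltW e0) ?(ltW r0).
Qed.

(* At [-iz - iT] the sine is dominated by one exponential, of size [e^T],
   whereas the perturbation stays bounded as [T] grows. *)
Lemma neuron_perturbed_sin (w : C -> C) (M : R) :
  (forall z, modc (w z) <= M) ->
  neuron (fun z => csin z + w z * cexp (- z)) (@cexp R).
Proof.
move=> wM r e e0.
have M0 : 0 <= M := le_trans (modc_ge0 _) (wM 0).
(* After scaling by 2 i t the perturbation is at most 2 t M e^r and the smaller exponential of the
   sine at most t e^r; together t K. *)
pose K := expR r * (1 + 2 * M).
have K0 : 0 < K by rewrite mulr_gt0 ?expR_gt0// ltr_pwDl// mulr_ge0.
pose t := Num.min 1 (e / K).
have t0 : 0 < t by rewrite lt_min ltr01 divr_gt0.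
have [t1 tK] : t <= 1 /\ t <= e / K by rewrite /t !ge_min !lexx orbT.
pose T := - ln t.
have T0 : 0 <= T by rewrite oppr_ge0 ln_le0.
have eT : cexp (- T%:C) = t%:C :> C.
  by rewrite -rmorphN/= cexp_real opprK lnK ?posrE.
have i2 : ('i : C) * 'i = -1 by rewrite -expr2 sqr_i.
(* With u = - i (x + T) one has i u = x + T, and the leading exponential of 2 i t sin u is exactly
   e^x because t = e^(-T). *)
exists (2 * 'i%C * t%:C), (- 'i%C), (- 'i%C * T%:C), 0 => x xr.
set u := - 'i%C * x + _.
have iu : 'i%C * u = x + T%:C by rewrite /u mulrDr mulrA mulrN i2 opprK mul1r mulrA mulrN i2 opprK mul1r.
have i0 : ('i%C : C) != 0 by rewrite eq_complex/= oner_eq0 andbF.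
have -> : 2 * 'i%C * t%:C * (csin u + w u * cexp (- u)) + 0 - cexp x =
   2 * 'i%C * t%:C * (w u * cexp (- u)) - t%:C * cexp (- (x + T%:C)).
  have tE : t%:C * cexp T%:C = 1 :> C by rewrite -eT -cexpD addNr cexp0.
  rewrite /csin -complexiE iu [cexp (x + _)]cexpD.
  rewrite [LHS](_ : _ = 2 * 'i%C * t%:C * (w u * cexp (- u)) -
    t%:C * cexp (- (x + T%:C)) + cexp x * (t%:C * cexp T%:C - 1)); last by field.
  by rewrite tE subrr mulr0 addr0.
have mt : modc (t%:C : C) = t by rewrite modcR gtr0_norm.
have m2it : modc (2 * 'i%C * t%:C : C) = 2 * t.
  by rewrite !modcM mt modci modc_nat mulr1.
rewrite (le_trans (modcB _ _))// (modcM (2 * 'i%C * t%:C)) m2it (modcM (w u)).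
rewrite (modcM t%:C) mt !modc_cexp.
have xr1 := le_trans (modc_Im x) xr; have xr2 := le_trans (modc_Re x) xr.
have E1 : expR (complex.Re (- u)) <= expR r.
  rewrite ler_expR (_ : complex.Re _ = - complex.Im x); last first.
    by rewrite /u; case: (x) => p q /=; ring.
  by rewrite (le_trans _ xr1)// -normrN ler_norm.
have E2 : expR (complex.Re (- (x + T%:C))) <= expR r.
  rewrite ler_expR (_ : complex.Re _ = - complex.Re x - T); last first.
    by case: (x) => p q /=; ring.
  rewrite lerBlDr (le_trans (_ : _ <= `|complex.Re x|))//.
    by rewrite -normrN ler_norm.
  by rewrite (le_trans xr2)// lerDl.
apply: (@le_trans _ _ (t * K)); last by rewrite -ler_pdivlMr.
have E3 : modc (w u) * expR (complex.Re (- u)) <= M * expR r.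
  by rewrite ler_pM ?modc_ge0 ?expR_ge0.
have h1 : t * (modc (w u) * expR (complex.Re (- u))) <= t * (M * expR r).
  by rewrite ler_wpM2l// ltW.
have h2 : t * expR (complex.Re (- (x + T%:C))) <= t * expR r.
  by rewrite ler_wpM2l// ltW.
by rewrite /K; lra.
Qed.

End Neurons.

(** * The algebra of exponentials and its realisation by networks *)

Section ExponentialFamily.
Variables (R : realType) (n : nat).
Local Notation C := R[i].
Variable D : set 'cV[C]_n.
Hypothesis Dbounded : exists r : R, forall z, D z -> forall i, modc (z i 0) <= r.

Definition exp_pair (a b : 'rV[C]_n) (z : 'cV[C]_n) : C :=
  cexp (linform b z) * conjc (cexp (linform a z)).

Definition exp_family : set ('cV[C]_n -> C) := [set f | exists a b, f = exp_pair a b].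

Lemma linformD (a b : 'rV[C]_n) z : linform (a + b) z = linform a z + linform b z.
Proof. by rewrite /linform mulmxDl mxE. Qed.

Lemma linformZ (k : C) (a : 'rV[C]_n) z : linform (k *: a) z = k * linform a z.
Proof. by rewrite /linform -scalemxAl mxE. Qed.

Lemma linform0 z : linform (0 : 'rV[C]_n) z = 0.
Proof. by rewrite /linform mul0mx mxE. Qed.

Lemma bounded_exp_linform b : bounded_on D (fun z => cexp (linform b z)).
Proof. exact: (bounded_ucont (@ucont_cexp R) (bounded_linform Dbounded b)). Qed.

Lemma exp_family_bounded : exp_family `<=` bounded_on (R := R) D.
Proof.
move=> _ [a [b ->]]; apply: bounded_onM; first exact: bounded_exp_linform.
by have [r Hr] := bounded_exp_linform a; exists r => z Dz; rewrite modc_conj Hr.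
Qed.

Lemma exp_family_mul : mul_closed exp_family.
Proof.
move=> _ _ [a [b ->]] [a' [b' ->]]; exists (a + a'), (b + b').
apply/funext => z; rewrite /exp_pair !linformD !cexpD.
by rewrite mulrACA -rmorphM.
Qed.

Local Notation A := (closed_span D exp_family).

Lemma exp_span1 : A (fun=> 1).
Proof.
apply: sub_closed_span; exists 0, 0; apply/funext => z.
by rewrite /exp_pair linform0 cexp0 mul1r rmorph1.
Qed.

(** [f] is the limit of (e^(h f) - 1) / h. The parameter h is real, hence commutes with conjugation,
    and the lemma also serves for the conjugates of linear forms. *)
Lemma exp_span_deriv (f : 'cV[C]_n -> C) : bounded_on D f ->
  (forall h : R, A (fun z => cexp (h%:C * f z))) -> A f.
Proof.
move=> [r fr] fA; have HS := closed_span_subspace D exp_family.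
apply: (subspace_lim HS) => e e0.
have r0 : 0 < `|r| + 1 by rewrite ltr_wpDl.
have [d d0 H] := cexp_diff0 (divr_gt0 e0 r0).
pose h := d / (`|r| + 1); have h0 : 0 < h by rewrite divr_gt0.
have hC0 : h%:C != 0 :> C.
  by rewrite -(rmorph0 (real_complex R)) (inj_eq (@complexI R)) lt0r_neq0.
exists (fun z => h^-1%:C * (cexp (h%:C * f z) - 1)).
  by apply: (subspaceZ HS); exact: (subspaceB HS (fA h) exp_span1).
move=> z Dz.
have xr' : modc (f z) <= `|r| + 1.
  by rewrite (le_trans (fr z Dz))// (le_trans (ler_norm _))// lerDl.
have hx : modc (h%:C * f z) <= d.
  by rewrite modcM modcR (gtr0_norm h0) -[leRHS](divfK (lt0r_neq0 r0)) ler_wpM2l// ltW.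
rewrite [X in modc X](_ : _ = h^-1%:C * (cexp (h%:C * f z) - 1 - h%:C * f z)); last first.
  by rewrite fmorphV/=; field; exact: hC0.
rewrite modcM modcR gtr0_norm ?invr_gt0// ler_pdivrMl//.
apply: (le_trans (H _ hx)); rewrite modcM modcR (gtr0_norm h0) mulrCA ler_wpM2l ?(ltW h0)//.
by rewrite -[leRHS](divfK (lt0r_neq0 r0)) ler_wpM2l// divr_ge0 ?(ltW e0) ?(ltW r0).
Qed.

Lemma exp_span_linform b : A (linform b).
Proof.
apply: exp_span_deriv; first exact: bounded_linform.
move=> h; apply: sub_closed_span; exists 0, (h%:C *: b); apply/funext => z.
by rewrite /exp_pair linform0 cexp0 rmorph1 mulr1 linformZ.
Qed.

Lemma exp_span_conj b : A (fun z => (linform b z)^*).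
Proof.
apply: exp_span_deriv.
  by have [r Hr] := bounded_linform Dbounded b; exists r => z Dz; rewrite modc_conj Hr.
move=> h; apply: sub_closed_span; exists (h%:C *: b), 0; apply/funext => z.
rewrite /exp_pair linform0 cexp0 mul1r linformZ cexp_conj.
by congr cexp; case: (linform b z) => p q; apply/eqP; rewrite eq_complex/=; apply/andP; split; apply/eqP; ring.
Qed.

Lemma linform_delta i (z : 'cV[C]_n) : linform (delta_mx 0 i) z = z i 0.
Proof. by rewrite /linform -rowE mxE. Qed.

Lemma exp_span_Re i : A (fun z => (complex.Re (z i 0))%:C).
Proof.
have HS := closed_span_subspace D exp_family.
apply: (subspace_eq HS _ (subspaceZ HS 2^-1 (subspaceD HS (exp_span_linform (delta_mx 0 i)) (exp_span_conj (delta_mx 0 i))))).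
by move=> z _; rewrite linform_delta addcJ mulKf// pnatr_eq0.
Qed.

Lemma exp_span_Im i : A (fun z => (complex.Im (z i 0))%:C).
Proof.
have HS := closed_span_subspace D exp_family.
apply: (subspace_eq HS _ (subspaceZ HS (2 * 'i%C)^-1 (subspaceB HS (exp_span_linform (delta_mx 0 i)) (exp_span_conj (delta_mx 0 i))))).
move=> z _; rewrite linform_delta subcJ; field.
by rewrite eq_complex/= oner_eq0 andbF.
Qed.

Variables (m : nat) (rho : C -> C).
Hypothesis urho : ucont rho.
Hypothesis nexp : neuron rho (@cexp R).
Hypothesis conj_chain :
  forall r, closed_span [set z | modc z <= r] (exp_chains rho) (fun z => z^*).

Let nid : neuron rho id := neuron_trans nexp (@neuron_cexp_id R).
Local Notation S := (scratch rho m D).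
Local Notation V := (addable rho m D).

Lemma scratch_ext s t : (forall z, s z = t z) -> S s -> S t.
Proof. by move=> st; have -> : s = t by exact/funext. Qed.

Lemma scratch_exp s a b : S s -> S (fun z => cexp (a * s z + linform b z)).
Proof.
move=> Ss; apply: scratch_ext (scratch_step Dbounded nid a b 0 nexp (@ucont_cexp R) Ss) => z.
by rewrite addr0.
Qed.

Lemma scratch_exp_linform b : S (fun z => cexp (linform b z)).
Proof.
apply: scratch_ext (scratch_exp 0 b (scratch0 rho m D)) => z.
by rewrite mul0r add0r.
Qed.

(** The product is the derivative at h = 0 of e^(h s + b.z). Both terms of the difference quotient
    fit in the scratch register, and the subtraction takes place in the outputs. *)
Lemma addable_exp_mul s b : S s -> V (fun z => cexp (linform b z) * s z).
Proof.
move=> Ss; have HV := addable_subspace rho m D.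
have [[r sr] _] := Ss; have [M HM] := bounded_exp_linform b.
apply: (subspace_lim HV) => e e0.
have r0 : 0 < `|r| + 1 by rewrite ltr_wpDl.
have M0 : 0 < `|M| + 1 by rewrite ltr_wpDl.
have [d d0 H] := cexp_diff0 (divr_gt0 (divr_gt0 e0 M0) r0).
pose h := d / (`|r| + 1); have h0 : 0 < h by rewrite divr_gt0.
have hC0 : h%:C != 0 :> C.
  by rewrite -(rmorph0 (real_complex R)) (inj_eq (@complexI R)) lt0r_neq0.
exists (fun z => h^-1%:C * (cexp (h%:C * s z + linform b z) - cexp (linform b z))).
  apply: (subspaceZ HV); apply: (subspaceB HV); apply: scratch_addable => //.
    exact: scratch_exp.
  exact: scratch_exp_linform.
move=> z Dz.
have xr' : modc (s z) <= `|r| + 1.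
  by rewrite (le_trans (sr z Dz))// (le_trans (ler_norm _))// lerDl.
have zM : modc (cexp (linform b z)) <= `|M| + 1.
  by rewrite (le_trans (HM z Dz))// (le_trans (ler_norm _))// lerDl.
have hx : modc (h%:C * s z) <= d.
  by rewrite modcM modcR (gtr0_norm h0) -[leRHS](divfK (lt0r_neq0 r0)) ler_wpM2l// ltW.
rewrite [X in modc X](_ : _ = cexp (linform b z) * (h^-1%:C * (cexp (h%:C * s z) - 1 - h%:C * s z))); last first.
  by rewrite cexpD fmorphV/=; field; exact: hC0.
rewrite modcM -[leRHS](divfK (lt0r_neq0 M0)) mulrC ler_pM ?modc_ge0//.
rewrite modcM modcR gtr0_norm ?invr_gt0// ler_pdivrMl//.
apply: (le_trans (H _ hx)); rewrite modcM modcR (gtr0_norm h0) mulrCA ler_wpM2l ?(ltW h0)//.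
rewrite -[leRHS](divfK (lt0r_neq0 r0)) ler_wpM2l//.
by rewrite !divr_ge0 ?(ltW e0) ?(ltW r0) ?(ltW M0).
Qed.

Lemma addable_chain f a b : exp_chains rho f ->
  V (fun z => cexp (linform b z) * f (cexp (linform a z))).
Proof.
have S1 := scratch_exp_linform a.
case=> [[c [d ->]]|[->|->]]; last exact: addable_exp_mul.
  apply: addable_exp_mul.
  have S2 := scratch_step Dbounded nid c 0 d nexp (@ucont_cexp R) S1.
  apply: scratch_ext (scratch_step Dbounded nid 1 0 0 (@neuron_self R rho) urho S2) => z.
  by rewrite !linform0 mul1r !addr0.
have HV := addable_subspace rho m D.
apply: (subspace_eq HV _ (scratch_addable (scratch_exp_linform b))) => z _.
by rewrite mulr1.
Qed.

Lemma exp_family_addable : exp_family `<=` V.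
Proof.
have HV := addable_subspace rho m D.
move=> _ [a [b ->]]; rewrite /exp_pair.
have [r Hr] := bounded_exp_linform a.
(* Induction on the span containing conjugation: both substituting x = e^(a.z) and multiplying by
   e^(b.z) are linear and respect uniform approximation, the radius [r] bounding e^(a.z) on [D]. *)
apply: (conj_chain (r := r) (V := [set f | V (fun z => cexp (linform b z) * f (cexp (linform a z)))])).
  have HM := mul_subspace HV (bounded_exp_linform b).
  split=> [|f g c Vf Vg|f fV] /=.
  - exact: (subspace0 HM).
  - exact: (subspaceDZ HM c Vf Vg).
  - apply: (subspace_lim HM) => e e0; have [g Vg gf] := fV e e0.
    by exists (fun z => g (cexp (linform a z))) => // z Dz; apply: gf; exact: Hr.
by move=> f; exact: addable_chain.
Qed.

Lemma exp_span_addable : A `<=` V.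
Proof.
by move=> f; apply; [exact: (addable_subspace rho m D)|exact: exp_family_addable].
Qed.

End ExponentialFamily.

(** * Weierstrass approximation on a box *)

Section Bernstein.
Variable R : realType.
Local Notation C := R[i].

(* Expectation of [f] under the binomial law of parameters [N], [x]. *)
Fixpoint binom_mean (K : comPzRingType) N (x : K) (f : nat -> K) : K :=
  if N is N'.+1 then x * binom_mean N' x (f \o S) + (1 - x) * binom_mean N' x f
  else f 0%N.

Lemma binom_mean_le N (x : R) (f g : nat -> R) : 0 <= x <= 1 ->
  (forall k, (k <= N)%N -> f k <= g k) -> binom_mean N x f <= binom_mean N x g.
Proof.
move=> /andP[x0 x1]; elim: N f g => [|N IH] f g fg /=; first exact: fg.
rewrite lerD// ler_wpM2l ?subr_ge0// IH// => k kN; apply: fg => //.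
exact: leqW.
Qed.

Lemma binom_meanDZ N (x a b : R) (f : nat -> R) :
  binom_mean N x (fun k => a + b * f k) = a + b * binom_mean N x f.
Proof. by elim: N f => [//|N IH] f /=; rewrite !IH; ring. Qed.

(** Squared bias plus variance of the binomial law; the centre [a] is general because the induction
    shifts it by 1. *)
Lemma binom_mean_sqr N (x a : R) :
  binom_mean N x (fun k => (k%:R - a) ^+ 2) =
  (N%:R * x - a) ^+ 2 + N%:R * (x * (1 - x)).
Proof.
elim: N a => [|N IH] a /=; first by ring.
rewrite IH; have -> : (fun k => (k%:R - a) ^+ 2) \o S =
    fun k => (k%:R - (a - 1)) ^+ 2.
  by apply/funext => k /=; rewrite -natr1; ring.
by rewrite IH -natr1; ring.
Qed.

Lemma binom_mean_modc N (x : R) (f : nat -> C) c : 0 <= x <= 1 ->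
  modc (binom_mean N x%:C f - c) <= binom_mean N x (fun k => modc (f k - c)).
Proof.
move=> /andP[x0 x1]; elim: N f => [//|N IH] f /=.
rewrite [X in modc X](_ : _ = x%:C * (binom_mean N x%:C (f \o S) - c) +
  (1 - x)%:C * (binom_mean N x%:C f - c)); last by rewrite rmorphB/=; ring.
rewrite (le_trans (modcD _ _))// !modcM !modcR !ger0_norm ?subr_ge0//.
by rewrite lerD// ler_wpM2l ?subr_ge0// IH.
Qed.

Section Freeze.
Variables (n : nat) (r : R).
Hypothesis r0 : 0 < r.
Local Notation T := 'cV[C]_n.

Definition box : set T :=
  [set z | forall i, `|complex.Re (z i 0)| <= r /\ `|complex.Im (z i 0)| <= r].

Definition coord (c : 'I_n * bool) (z : T) : R :=
  if c.2 then complex.Re (z c.1 0) else complex.Im (z c.1 0).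

Definition upd (c : 'I_n * bool) (v : R) (z : T) : T :=
  \col_j (if j == c.1 then
    (if c.2 then v +i* complex.Im (z j 0) else complex.Re (z j 0) +i* v)
    else z j 0).

Lemma coord_upd c c' v z : coord c' (upd c v z) = if c' == c then v else coord c' z.
Proof.
case: c c' => [i b] [i' b']; rewrite /coord !mxE/= xpair_eqE.
by have [->|] := eqVneq i' i => //=; case: b; case: b'.
Qed.

Lemma box_coord z : box z <-> forall c, `|coord c z| <= r.
Proof.
split=> [bz [i b]|H i]; first by have [h1 h2] := bz i; case: b.
by split; [exact: (H (i, true))|exact: (H (i, false))].
Qed.

Lemma box_upd c v z : `|v| <= r -> box z -> box (upd c v z).
Proof.
move=> vr /box_coord bz; apply/box_coord => c'.
by rewrite coord_upd; case: ifP.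
Qed.

Lemma coord_inj z z' : (forall c, coord c z = coord c z') -> z = z'.
Proof.
move=> H; apply/colP => i; have := H (i, true); have := H (i, false).
by rewrite /coord/=; case: (z i 0) => a b; case: (z' i 0) => a' b' /= -> ->.
Qed.

Lemma upd_dist c v z j : modc (upd c v z j 0 - z j 0) <= `|v - coord c z|.
Proof.
rewrite mxE; case: c => i b /=; have [->|_] := eqVneq j i; last by rewrite subrr modc0.
rewrite /coord/= (le_trans (modc_ReIm _))//.
by case: b; case: (z i 0) => p q /=; rewrite subrr normr0 ?addr0 ?add0r.
Qed.

Lemma upd_contract c v z z' j :
  modc (upd c v z j 0 - upd c v z' j 0) <= modc (z j 0 - z' j 0).
Proof.
rewrite !mxE; case: c => i b /=; case: (j == i) => //.
have := modc_Re (z j 0 - z' j 0); have := modc_Im (z j 0 - z' j 0).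
case: b; case: (z j 0) => p q; case: (z' j 0) => p' q' /= h1 h2;
  apply: (le_trans (modc_ReIm _)); rewrite /= subrr normr0 ?add0r ?addr0//.
Qed.

Definition ucont_box (g : T -> C) := forall e : R, 0 < e -> exists2 d : R, 0 < d &
  forall z z', box z -> box z' -> (forall j, modc (z j 0 - z' j 0) <= d) ->
    modc (g z - g z') <= e.

Variable V : set (T -> C).
Hypotheses (HV : closed_subspace box V) (VM : mul_closed V) (V1 : V (fun=> 1)).
Hypothesis Vcoord : forall c, V (fun z => (coord c z)%:C).

Lemma binom_mean_mem N (t : T -> C) (f : nat -> T -> C) : V t ->
  (forall k, (k <= N)%N -> V (f k)) ->
  V (fun z => binom_mean N (t z) (fun k => f k z)).
Proof.
move=> Vt; elim: N f => [|N IH] f Vf /=; first exact: Vf.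
apply: (subspaceD HV); apply: VM => //.
- by apply: (IH (fun k => f k.+1)) => k kN; exact: Vf.
- exact: (subspaceB HV).
- by apply: IH => k kN; apply: Vf; exact: leqW.
Qed.

(** Induction on the list of real coordinates on which [g] depends. The Bernstein polynomial in the
    first one has as coefficients [g] with that coordinate frozen at grid points, and these depend
    on the remaining ones only. *)
Lemma box_weierstrass_dep (s : seq ('I_n * bool)) (g : T -> C) :
  ucont_box g -> bounded_on box g ->
  (forall z z', box z -> box z' -> {in s, forall c, coord c z = coord c z'} -> g z = g z') ->
  V g.
Proof.
elim: s g => [|c s IH] g ug [B gB] gdep.
  have b0 : box 0 by move=> i; rewrite mxE /= normr0 ltW.
  apply: (subspace_eq HV _ (subspaceZ HV (g 0) V1)) => z bz.
  by rewrite mulr1; apply: gdep.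
apply: (subspace_lim HV) => e e0; have e20 : 0 < e / 2 by rewrite divr_gt0.
have [d d0 gd] := ug _ e20.
(* Chebyshev again: a grid value farther than d from the coordinate costs 2 |B| <= 2 |B| (v k -
   coord c z)^2 / d^2, where v k - coord c z = (2 r / N) (k - N x). The variance N x (1 - x) <= N
   bounds the mean by K / N. *)
pose K := 2 * `|B| * (2 * r) ^+ 2 / d ^+ 2.
have [N N0 HN] := exists_nat_inv_lt K e20.
have {HN} := HN N (leqnn _) => HN.
have NR : 0 < N%:R :> R by rewrite ltr0n.
pose v k : R := - r + 2 * r * (k%:R / N%:R).
have vr k : (k <= N)%N -> `|v k| <= r.
  move=> kN; have h1 : 0 <= k%:R / N%:R :> R by rewrite divr_ge0.
  have h2 : k%:R / N%:R <= 1 :> R by rewrite ler_pdivrMr// mul1r ler_nat.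
  have h3 : 0 <= r * (k%:R / N%:R) by rewrite mulr_ge0 ?(ltW r0).
  have h4 : r * (k%:R / N%:R) <= r by rewrite ler_piMr ?(ltW r0).
  by rewrite ler_norml /v -mulrA; lra.
pose x z : R := (coord c z + r) / (2 * r).
have r20 : 0 < 2 * r by rewrite mulr_gt0.
exists (fun z => binom_mean N (x z)%:C (fun k => g (upd c (v k) z))).
  apply: (binom_mean_mem (t := fun z => (x z)%:C) (f := fun k z => g (upd c (v k) z))).
    apply: (subspace_eq HV _ (subspaceZ HV (2 * r)^-1%:C (subspaceD HV (Vcoord c) (subspaceZ HV r%:C V1)))).
    by move=> z _; rewrite mulr1 -rmorphD -rmorphM/= mulrC.
  move=> k kN; apply: IH.
  - move=> e' e'0; have [d' d'0 gd'] := ug e' e'0; exists d' => // z z' bz bz' zz'.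
    apply: gd'; [exact/box_upd/bz/vr|exact/box_upd/bz'/vr|] => j.
    exact: le_trans (upd_contract _ _ _ _ _) (zz' j).
  - by exists B => z bz; apply: gB; apply: box_upd => //; exact: vr.
  - move=> z z' bz bz' zz'; apply: gdep; [exact/box_upd/bz/vr|exact/box_upd/bz'/vr|] => c'.
    rewrite inE !coord_upd => /orP[->//|c's]; case: ifP => // _; exact: zz'.
move=> z bz.
have /box_coord/(_ c) := bz; rewrite ler_norml => /andP[cr1 cr2].
have x01 : 0 <= x z <= 1.
  by rewrite /x divr_ge0 ?(ltW r20) ?ler_pdivrMr//=; lra.
apply: (le_trans (binom_mean_modc _ _ _ x01)).
have d20 : 0 < d ^+ 2 by rewrite exprn_gt0.
apply: (@le_trans _ _ (binom_mean N (x z) (fun k => e / 2 +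
    K / N%:R ^+ 2 * (k%:R - N%:R * x z) ^+ 2))).
  apply: binom_mean_le => // k kN.
  have vx : v k - coord c z = (2 * r) / N%:R * (k%:R - N%:R * x z).
    by rewrite /v /x; field; rewrite !lt0r_neq0.
  have KE : K / N%:R ^+ 2 * (k%:R - N%:R * x z) ^+ 2 =
      2 * `|B| * (v k - coord c z) ^+ 2 / d ^+ 2.
    by rewrite vx /K; field; rewrite !lt0r_neq0.
  rewrite KE.
  have [h|h] := leP `|v k - coord c z| d.
    apply: ler_wpDr; first by rewrite divr_ge0 ?(ltW d20)// mulr_ge0 ?sqr_ge0// mulr_ge0.
    apply: gd => //; first exact/box_upd/bz/vr.
    by move=> j; rewrite (le_trans (upd_dist _ _ _ _)).
  apply: ler_wpDl; first exact: ltW.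
  apply: (@le_trans _ _ (2 * `|B|)).
    rewrite (le_trans (modcB _ _))// mulr_natl mulr2n.
    by rewrite lerD// (le_trans (gB _ _)) ?ler_norm//; exact/box_upd/bz/vr.
  rewrite -mulrA ler_peMr ?mulr_ge0// ler_pdivlMr// mul1r.
  by rewrite -[leRHS]real_normK ?num_real// lerXn2r ?nnegrE ?(ltW d0) ?(ltW h).
rewrite binom_meanDZ binom_mean_sqr subrr expr0n add0r [leRHS]splitr lerD2l.
apply: (le_trans _ HN).
have K0 : 0 <= K / N%:R.
  by rewrite divr_ge0 ?(ltW NR)// divr_ge0 ?(ltW d20)// mulr_ge0 ?sqr_ge0// mulr_ge0.
rewrite [leLHS](_ : _ = K / N%:R * (x z * (1 - x z))); last by field; rewrite lt0r_neq0.
rewrite ler_piMr//; move: x01 => /andP[? ?]; nra.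
Qed.

Lemma box_weierstrass (g : T -> C) : ucont_box g -> bounded_on box g -> V g.
Proof.
move=> ug bg; apply: (box_weierstrass_dep (s := enum {: 'I_n * bool})) => // z z' _ _ H.
by congr g; apply: coord_inj => c; apply: H; rewrite mem_enum.
Qed.

End Freeze.
End Bernstein.

(** * Topology of the complex plane *)

Section Topology.
Variable R : realType.
Local Notation C := R[i].

(** Norms and radii on [C] take values in [C], where a positive element is real; this allows the
    passage to real epsilons. *)
Lemma gt0_complex (e : C) : 0 < e -> exists2 e' : R, 0 < e' & e = e'%:C.
Proof.
case: e => a b; rewrite ltcE/= => /andP[/eqP -> a0]; by exists a.
Qed.

Lemma cvg_modc (T : Type) (F : set_system T) (FF : Filter F) (f : T -> C) (l : C) :
  f @ F --> l <-> forall e : R, 0 < e -> \forall t \near F, modc (l - f t) <= e.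
Proof.
split=> [/cvgrPdist_le H e e0|H].
  have := H e%:C; rewrite ltcR => /(_ e0); apply: filterS => t.
  by rewrite norm_modc lecR.
apply/cvgrPdist_le => e /gt0_complex[e' e'0 ->].
by have := H e' e'0; apply: filterS => t; rewrite norm_modc lecR.
Qed.

Lemma near_dnbhsC (P : C -> Prop) : (\forall h \near 0^', P h) <->
  exists2 d : R, 0 < d & forall h, modc h <= d -> h != 0 -> P h.
Proof.
split=> [/nbhs_ballP[_ /gt0_complex[d d0 ->] H]|[d d0 H]].
  exists (d / 2); first by rewrite divr_gt0.
  move=> h hd h0; apply: H => //; rewrite /ball/= /ball_/= sub0r normrN norm_modc ltcR.
  by rewrite (le_lt_trans hd)// ltr_pdivrMr// ltr_pMr// ltr1n.
apply/nbhs_ballP; exists d%:C; first by rewrite /= ltcR.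
move=> h; rewrite /ball/= /ball_/= sub0r normrN norm_modc ltcR => hd h0.
by apply: H => //; exact: ltW.
Qed.

Lemma near_dnbhsR (P : R -> Prop) :
  (exists2 d : R, 0 < d & forall h, `|h| <= d -> h != 0 -> P h) ->
  (\forall h \near 0^', P h).
Proof.
move=> [d d0 H]; apply/nbhs_ballP; exists d => //.
move=> h; rewrite /ball/= /ball_/= sub0r normrN => hd h0.
by apply: H => //; exact: ltW.
Qed.

(** The partial derivatives come from the expansion by restricting the increment to the two axes. *)
Lemma real_differentiable_atP (f : C -> C) z0 :
  real_differentiable_at f z0 <-> eps_rdiff f z0.
Proof.
split=> [[dx [dy [_ [_ /cvg_modc H]]]]|[dx [dy H]]].
  exists dx, dy => e e0; have /near_dnbhsC[d d0 {}H] := H e e0.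
  exists d => // h hd; have [->|h0] := eqVneq h 0.
    by rewrite addr0 subrr rmorph0 !mulr0 !subr0 modc0 mulr0.
  have := H h hd h0; rewrite sub0r modcN modcM modcV ler_pdivrMr//.
  exact: modc_gt0.
exists dx, dy; split; last split.
- apply/cvg_modc => e e0; apply: near_dnbhsR; have [d d0 Hd] := H e e0.
  exists d => // t td t0; have := Hd t%:C; rewrite modcR => /(_ td).
  have tC : t%:C != 0 :> C.
    by rewrite -(rmorph0 (real_complex R)) (inj_eq (@complexI R)).
  rewrite /= rmorph0 mulr0 subr0 => h.
  rewrite [X in modc X](_ : _ = - (t%:C^-1 * (f (z0 + t%:C) - f z0 - dx * t%:C))).
    by rewrite modcN modcM modcV modcR ler_pdivrMl ?normr_gt0// [leRHS]mulrC.
  by rewrite fmorphV/=; field; exact: tC.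
- apply/cvg_modc => e e0; apply: near_dnbhsR; have [d d0 Hd] := H e e0.
  exists d => // t td t0; have := Hd ('i%C * t%:C).
  rewrite modcM modci mul1r modcR => /(_ td).
  have tC : t%:C != 0 :> C.
    by rewrite -(rmorph0 (real_complex R)) (inj_eq (@complexI R)).
  have -> : complex.Re ('i%C * t%:C : C) = 0 by rewrite /=; ring.
  have -> : complex.Im ('i%C * t%:C : C) = t by rewrite /=; ring.
  rewrite rmorph0 mulr0 subr0 => h; rewrite -complexiE.
  rewrite [X in modc X](_ : _ = - (t%:C^-1 * (f (z0 + 'i%C * t%:C) - f z0 - dy * t%:C))).
    by rewrite modcN modcM modcV modcR ler_pdivrMl ?normr_gt0// [leRHS]mulrC.
  by rewrite fmorphV/=; field; exact: tC.
- apply/cvg_modc => e e0; apply/near_dnbhsC; have [d d0 Hd] := H e e0.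
  exists d => // h hd h0; rewrite sub0r modcN modcM modcV ler_pdivrMr ?modc_gt0//.
  exact: Hd.
Qed.

Section Compact.
Variables (M : pseudoMetricType C) (K : set M) (f : M -> C).
Hypotheses (Kc : compact K) (fc : continuous f).

Lemma continuous_near (x : M) (e : R) : 0 < e ->
  \forall y \near x, modc (f x - f y) <= e.
Proof. by move=> e0; have /cvg_modc := fc (x := x); exact. Qed.

Lemma compact_fun_bounded : exists B : R, forall x, K x -> modc (f x) <= B.
Proof.
have /compact_near_coveringP/(_ R +oo%R (fun B x => modc (f x) <= B)) := Kc.
case=> [x _|B [_ HB]]; last by exists (B + 1); apply: HB; rewrite ltrDl.
have h1 := continuous_near x ltr01.
exists ([set y | modc (f x - f y) <= 1], [set B | modc (f x) + 1 < B]).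
  by split=> //=; exists (modc (f x) + 1); split=> //; exact: num_real.
move=> [y B] /= [hy hB]; apply/ltW; apply: le_lt_trans hB.
by rewrite (le_trans (modc_le_add _ (f x)))// lerD2l modc_sym.
Qed.

(** The near-covering form of compactness, with radii tending to 0 from the right, makes a locally
    valid radius uniform over [K]. Only [x] has to lie in [K]. *)
Lemma compact_ucont (e : R) : 0 < e -> exists2 d : R, 0 < d &
  forall x y, K x -> ball x d%:C y -> modc (f x - f y) <= e.
Proof.
move=> e0; have e20 : 0 < e / 2 by rewrite divr_gt0.
have /compact_near_coveringP/(_ R (0 : R)^'+ (fun d x => forall y, ball x d%:C y ->
  modc (f x - f y) <= e)) := Kc.
case=> [x _|d /= d0 Hd].
  have /nbhs_ballP[_ /gt0_complex[d d0 ->] H] := continuous_near x e20.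
  have d20 : 0 < d / 2 by rewrite divr_gt0.
  exists (ball x (d / 2)%:C, [set t | t < d / 2]).
    split=> /=; first by apply: nbhsx_ballx; rewrite ltcR.
    exact: nbhs_right_lt.
  move=> [x' t] /= [xx' td] y x'y.
  apply: (le_trans (modc_trans (f x) _ _)); rewrite (splitr e) lerD//.
    rewrite modc_sym; apply: H; apply: le_ball xx'; rewrite lecR.
    by rewrite ler_pdivrMr// ler_peMr ?ler1n// ltW.
  apply: H; rewrite (splitr d) rmorphD/=; apply: ball_triangle xx' _.
  by apply: le_ball x'y; rewrite lecR ltW.
exists (d / 2); first by rewrite divr_gt0.
move=> x y Kx xy; apply: (Hd (d / 2)) => //; last by rewrite divr_gt0.
rewrite /= /ball_ sub0r normrN gtr0_norm ?divr_gt0//.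
by rewrite ltr_pdivrMr// ltr_pMr// ltr1n.
Qed.

End Compact.

Lemma continuous_Complex : continuous (fun p : R * R => p.1 +i* p.2 : C).
Proof.
move=> p; apply/cvg_modc => e e0.
exists (ball p.1 (e / 2), ball p.2 (e / 2)).
  by split; apply: nbhsx_ballx; rewrite divr_gt0.
move=> q [/= h1 h2]; rewrite (le_trans (modc_ReIm _))//=.
by rewrite (splitr e) lerD// ltW.
Qed.

Definition square (r : R) : set C :=
  [set z | `|complex.Re z| <= r /\ `|complex.Im z| <= r].

Lemma square_compact r : compact (square r).
Proof.
have -> : square r = (fun p : R * R => p.1 +i* p.2 : C) @` (`[- r, r] `*` `[- r, r]).
  apply/seteqP; split=> [[a b] [/= h1 h2]|_ [[a b] [/= h1 h2] <-]].
    by exists (a, b) => //; split=> /=; rewrite in_itv/= -ler_norml.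
  by split; rewrite ler_norml; move: h1 h2; rewrite !in_itv.
apply: continuous_compact; last by apply: compact_setX; exact: segment_compact.
exact/continuous_subspaceT/continuous_Complex.
Qed.

Lemma box_compact n (r : R) : compact (box r : set 'cV[C]_n).
Proof.
have -> : box r = (fun v : 'rV[C]_n => v^T) @` [set v : 'rV[C]_n | forall i, square r (v ord0 i)].
  apply/seteqP; split=> [z bz|_ [v bv <-] i].
    exists z^T; last by rewrite trmxK.
    by move=> i; rewrite mxE; exact: bz.
  by rewrite mxE; exact: bv.
apply: continuous_compact; last by apply: (@rV_compact C n (fun=> square r)) => i; exact: square_compact.
apply/continuous_subspaceT => v s /= /nbhs_ballP[e e0 es].
apply/nbhs_ballP; exists e => //= u [_ vu]; apply: es; split=> // i j.
by rewrite !mxE; exact: vu.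
Qed.

Lemma continuous_ucont (w : C -> C) : continuous w -> ucont w.
Proof.
move=> wc r e e0.
have [d d0 H] := compact_ucont (@square_compact r) wc e0.
exists (d / 2); first by rewrite divr_gt0.
move=> x y xr yr xy; apply: H.
  by split; [exact: le_trans (modc_Re _) xr|exact: le_trans (modc_Im _) xr].
rewrite /ball/= /ball_/= norm_modc ltcR (le_lt_trans xy)//.
by rewrite ltr_pdivrMr// ltr_pMr// ltr1n.
Qed.

Lemma continuous_ucont_box n (r : R) (g : 'cV[C]_n -> C) : continuous g -> ucont_box r g.
Proof.
move=> gc e e0; have [d d0 H] := compact_ucont (@box_compact n r) gc e0.
exists (d / 2); first by rewrite divr_gt0.
move=> x y xr yr xy; apply: H => //; split; first by rewrite ltcR.
move=> i j; rewrite ord1 /ball/= /ball_/= norm_modc ltcR (le_lt_trans (xy i))//.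
by rewrite ltr_pdivrMr// ltr_pMr// ltr1n.
Qed.

Lemma compact_in_box n (K : set 'cV[C]_n) : compact K ->
  exists2 r : R, 0 < r & K `<=` box r.
Proof.
move=> Kc.
have /choice[B HB] : forall i : 'I_n, exists B : R, forall z, K z -> modc (z i 0) <= B.
  by move=> i; apply: (compact_fun_bounded Kc); exact: coord_continuous.
exists (\sum_i `|B i| + 1); first by rewrite ltr_wpDl// sumr_ge0.
move=> z Kz i; have zi : modc (z i 0) <= \sum_i `|B i| + 1.
  rewrite (le_trans (HB i z Kz))// (le_trans (ler_norm _))// (bigD1 i)//= -addrA.
  by rewrite lerDl addr_ge0// sumr_ge0.
by split; [exact: le_trans (modc_Re _) zi|exact: le_trans (modc_Im _) zi].
Qed.

Lemma mx_norm_le k (v : 'cV[C]_k) (e : R) : 0 <= e ->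
  (forall i, modc (v i 0) <= e) -> `|v| <= e%:C.
Proof.
move=> e0 H; rewrite /Num.norm/=.
have [->|/mx_norm_neq0[[i j] ->]] := eqVneq (mx_norm v) 0.
  by rewrite -(rmorph0 (real_complex R)) lecR.
by rewrite ord1/= norm_modc lecR.
Qed.

End Topology.

(** * Perturbed sine *)

Section RealDifferentiation.
Variable R : realType.
Local Notation C := R[i].
Implicit Types (f g : C -> C) (z : C).

Lemma eps_rdiff_ext f g z : (forall x, f x = g x) -> eps_rdiff f z -> eps_rdiff g z.
Proof. by move=> fg; have -> : f = g by exact/funext. Qed.

Lemma eps_rdiff_holo f z c : (forall e : R, 0 < e -> exists2 d : R, 0 < d &
    forall h, modc h <= d -> modc (f (z + h) - f z - c * h) <= e * modc h) ->
  eps_rdiff f z.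
Proof.
move=> H; exists c, (c * 'i%C) => e e0; have [d d0 Hd] := H e e0.
exists d => // h /Hd; apply: le_trans; rewrite le_eqVlt; apply/orP; left; apply/eqP.
by congr modc; rewrite [X in _ = _ - c * X](complexE h); ring.
Qed.

(** For the product rule: it makes the product of the two increments of second order. *)
Lemma eps_rdiff_lipschitz f z : eps_rdiff f z ->
  exists A d : R, [/\ 0 <= A, 0 < d &
    forall h, modc h <= d -> modc (f (z + h) - f z) <= A * modc h].
Proof.
move=> [dx [dy H]]; have [d d0 Hd] := H 1 ltr01.
exists (1 + modc dx + modc dy), d; split=> //; first by rewrite !addr_ge0 ?modc_ge0.
move=> h hd; have := Hd h hd; set X := _ - dy * _ => HX.
have -> : f (z + h) - f z = X + dx * (complex.Re h)%:C + dy * (complex.Im h)%:C.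
  by rewrite /X; ring.
rewrite (le_trans (modcD _ _))// mulrDl lerD//; last first.
  by rewrite modcM modcR ler_wpM2l ?modc_ge0 ?modc_Im.
rewrite (le_trans (modcD _ _))// mulrDl lerD//.
by rewrite modcM modcR ler_wpM2l ?modc_ge0 ?modc_Re.
Qed.

Lemma eps_rdiff_mul f g z : eps_rdiff f z -> eps_rdiff g z ->
  eps_rdiff (fun x => f x * g x) z.
Proof.
move=> df dg.
have [A [da [A0 da0 HA]]] := eps_rdiff_lipschitz df.
have [B [db [B0 db0 HB]]] := eps_rdiff_lipschitz dg.
have [fx [fy Hf]] := df; have [gx [gy Hg]] := dg.
exists (f z * gx + g z * fx), (f z * gy + g z * fy) => e e0.
have e30 : 0 < e / 3 by rewrite divr_gt0.
have F0 : 0 < modc (f z) + 1 by rewrite ltr_wpDl ?modc_ge0.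
have G0 : 0 < modc (g z) + 1 by rewrite ltr_wpDl ?modc_ge0.
have AB0 : 0 < A * B + 1 by rewrite ltr_wpDl// mulr_ge0.
have [d1 d10 H1] := Hf _ (divr_gt0 e30 G0).
have [d2 d20 H2] := Hg _ (divr_gt0 e30 F0).
exists (Num.min (Num.min da db) (Num.min (Num.min d1 d2) (e / 3 / (A * B + 1)))).
  by rewrite !lt_min da0 db0 d10 d20 divr_gt0.
move=> h; rewrite !le_min => /andP[/andP[ha hb] /andP[/andP[h1 h2] h3]].
have {}H1 := H1 h h1; have {}H2 := H2 h h2.
have {}HA := HA h ha; have {}HB := HB h hb.
move: H1 H2; set X := _ - fy * _; set Y := _ - gy * _ => H1 H2.
rewrite [X in modc X](_ : _ = f z * Y + g z * X +
   (f (z + h) - f z) * (g (z + h) - g z)); last by rewrite /X /Y; ring.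
have m0 := modc_ge0 h.
rewrite (_ : e = e / 3 + e / 3 + e / 3); last by field.
rewrite (le_trans (modcD _ _))// [leRHS]mulrDl lerD//; last first.
  rewrite modcM (le_trans (ler_pM _ _ HA HB)) ?modc_ge0// mulrACA.
  rewrite [modc h * _]mulrC mulrA ler_wpM2r//.
  rewrite (le_trans (_ : _ <= (A * B + 1) * modc h))//; last first.
    by rewrite mulrC -ler_pdivlMr.
  by rewrite ler_wpM2r// lerDl.
rewrite (le_trans (modcD _ _))// [leRHS]mulrDl lerD// modcM.
  rewrite -[e / 3 in leRHS](divfK (lt0r_neq0 F0)) [_ / _ * _ in leRHS]mulrC -mulrA.
  by rewrite ler_pM ?modc_ge0// lerDl.
rewrite -[e / 3 in leRHS](divfK (lt0r_neq0 G0)) [_ / _ * _ in leRHS]mulrC -mulrA.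
by rewrite ler_pM ?modc_ge0// lerDl.
Qed.

Lemma eps_rdiff_sub f g z : eps_rdiff f z -> eps_rdiff g z ->
  eps_rdiff (fun x => f x - g x) z.
Proof.
move=> [fx [fy Hf]] [gx [gy Hg]]; exists (fx - gx), (fy - gy) => e e0.
have e20 : 0 < e / 2 by rewrite divr_gt0.
have [d1 d10 H1] := Hf _ e20; have [d2 d20 H2] := Hg _ e20.
exists (Num.min d1 d2); first by rewrite lt_min d10.
move=> h; rewrite le_min => /andP[/H1 {}H1 /H2 {}H2].
move: H1 H2; set X := _ - fy * _; set Y := _ - gy * _ => H1 H2.
rewrite [X in modc X](_ : _ = X - Y); last by rewrite /X /Y; ring.
by rewrite (le_trans (modcB _ _))// (splitr e) mulrDl lerD.
Qed.

Lemma eps_rdiff_cst (c : C) z : eps_rdiff (fun=> c) z.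
Proof.
apply: (@eps_rdiff_holo _ _ 0) => e e0; exists 1 => // h _.
by rewrite subrr mul0r subr0 modc0 mulr_ge0 ?modc_ge0 ?ltW.
Qed.

Lemma eps_rdiff_cexpM (a : C) z : eps_rdiff (fun x => cexp (a * x)) z.
Proof.
apply: (@eps_rdiff_holo _ _ (cexp (a * z) * a)) => e e0.
pose K := modc (cexp (a * z)) * modc a + 1.
have K0 : 0 < K by rewrite ltr_wpDl// mulr_ge0 ?modc_ge0.
have [d d0 H] := cexp_diff0 (divr_gt0 e0 K0).
have a0 : 0 < modc a + 1 by rewrite ltr_wpDl ?modc_ge0.
exists (d / (modc a + 1)); first by rewrite divr_gt0.
move=> h hd; have m0 := modc_ge0 h.
have ahd : modc (a * h) <= d.
  rewrite modcM (le_trans (_ : _ <= (modc a + 1) * modc h))//.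
    by rewrite ler_wpM2r// lerDl.
  by rewrite mulrC -ler_pdivlMr.
rewrite [X in modc X](_ : _ = cexp (a * z) * (cexp (a * h) - 1 - a * h)); last first.
  by rewrite mulrDr cexpD; ring.
rewrite modcM (le_trans (ler_wpM2l (modc_ge0 _) (H _ ahd)))// modcM.
rewrite [leLHS](_ : _ = modc (cexp (a * z)) * modc a * (e / K) * modc h); last by ring.
rewrite ler_wpM2r// -[leRHS](divfK (lt0r_neq0 K0)) [leRHS]mulrC ler_wpM2r//.
  by rewrite divr_ge0 ?(ltW e0) ?(ltW K0).
by rewrite lerDl.
Qed.

Lemma csinE z : csin z = ((2 * 'i)^-1 : C) * (cexp ('i * z) - cexp (- 'i * z)).
Proof. by rewrite /csin mulNr mulrC. Qed.

Lemma eps_rdiff_csin z : eps_rdiff (@csin R) z.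
Proof.
apply: (@eps_rdiff_ext (fun z => ((2 * 'i)^-1 : C) * (cexp ('i * z) - cexp (- 'i * z)))).
  by move=> x; rewrite csinE.
apply: eps_rdiff_mul; first exact: eps_rdiff_cst.
by apply: eps_rdiff_sub; exact: eps_rdiff_cexpM.
Qed.

Lemma ucont_ext f g : (forall x, f x = g x) -> ucont f -> ucont g.
Proof. by move=> fg; have -> : f = g by exact/funext. Qed.

Lemma ucont_cexpM (a : C) : ucont (fun x => cexp (a * x)).
Proof.
apply: (ucont_ext _ (ucont_comp (@ucont_cexp R) (ucont_affine a 0))) => x.
by rewrite /= addr0.
Qed.

Lemma ucont_cst (c : C) : ucont (fun=> c).
Proof. by apply: (ucont_ext _ (ucont_affine 0 c)) => x; rewrite mul0r add0r. Qed.

Lemma ucont_csin : ucont (@csin R).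
Proof.
apply: (@ucont_ext (fun z => ((2 * 'i)^-1 : C) * (cexp ('i * z) + -1 * cexp (- 'i * z)))).
  by move=> x; rewrite csinE mulN1r.
apply: ucont_mul; first exact: ucont_cst.
apply: ucont_add; first exact: ucont_cexpM.
by apply: ucont_mul; [exact: ucont_cst|exact: ucont_cexpM].
Qed.

End RealDifferentiation.

Section PerturbedSine.
Variables (R : realType) (w : R[i] -> R[i]).
Hypotheses (wc : continuous w) (wb : bounded_cfun w).
Hypothesis wn : nowhere_real_differentiable w.
Local Notation C := R[i].
Let rho (z : C) : C := csin z + w z * cexp (- z).

(** [w] equals (rho - sin) * exp, and sin and exp are real differentiable everywhere, so
    differentiability of [rho] at a point would pass to [w]. *)
Lemma perturbed_sin_nowhere : nowhere_real_differentiable rho.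
Proof.
move=> z0 /real_differentiable_atP dr; apply: (wn (z0 := z0)).
apply/real_differentiable_atP.
apply: (@eps_rdiff_ext _ (fun z => (rho z - csin z) * cexp (1 * z))).
  by move=> z; rewrite /rho mul1r addrC addKr -mulrA -cexpD addNr cexp0 mulr1.
apply: eps_rdiff_mul; last exact: eps_rdiff_cexpM.
by apply: eps_rdiff_sub => //; exact: eps_rdiff_csin.
Qed.

Lemma ucont_perturbed_sin : ucont rho.
Proof.
apply: ucont_add; first exact: ucont_csin.
apply: ucont_mul; first exact: continuous_ucont.
by apply: (ucont_ext _ (ucont_cexpM (-1))) => z; rewrite mulN1r.
Qed.

Lemma perturbed_sin_universal n m : universal n m (NN rho n m (n + m + 1)).
Proof.
move=> g gc K Kc eps eps0.
have [r r0 KD] := compact_in_box Kc.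
pose D : set 'cV[C]_n := box r.
have Db : exists r' : R, forall z, D z -> forall i, modc (z i 0) <= r'.
  exists (r + r) => z Dz i; have [h1 h2] := Dz i.
  by rewrite (le_trans (modc_ReIm _))// lerD.
have [M HM] := wb.
have nexp : neuron rho (@cexp R).
  by apply: (neuron_perturbed_sin (M := M)) => z; have := HM z; rewrite norm_modc lecR.
have nid : neuron rho id := neuron_trans nexp (@neuron_cexp_id R).
have nd : ~ eps_rdiff rho 0.
  by move=> /real_differentiable_atP; exact: perturbed_sin_nowhere.
have urho := ucont_perturbed_sin.
have AV : closed_span D (@exp_family R n) `<=` addable rho m D.
  exact: (exp_span_addable Db m urho nexp (conj_in_span urho nd)).
have Vg i : addable rho m D (fun z => g z i 0).
  apply: AV.
  have gic : continuous (fun z : 'cV[C]_n => g z i 0).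
    by move=> z s hs; have := gc z _ (@coord_continuous C m 1 i 0 (g z) s hs).
  apply: (box_weierstrass r0 (closed_span_subspace _ _)).
  - exact: (closed_span_mul (@exp_family_mul R n) (exp_family_bounded Db)).
  - exact: exp_span1.
  - by move=> [j []]; rewrite /coord/=; [exact: exp_span_Re|exact: exp_span_Im].
  - exact: continuous_ucont_box.
  - exact: (compact_fun_bounded (@box_compact R n r) gic).
have e20 : 0 < eps / 2 by rewrite divr_gt0.
have [f fN fg] := outputs_NN nid (addable_outputs Vg) e20.
(* Universality asks for a bound strictly below [eps], hence the half. *)
exists f; split=> //; exists (eps / 2); split.
  by rewrite ltr_pdivrMr// ltr_pMr// ltr1n.
move=> z Kz; apply: mx_norm_le; first exact: ltW.
by move=> i; rewrite !mxE; apply: fg; exact: KD.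
Qed.

End PerturbedSine.

Theorem theorem6p5 (R : realType) (w : R[i] -> R[i]) :
  continuous w -> bounded_cfun w -> nowhere_real_differentiable w ->
  let rho := fun z : R[i] => csin z + w z * cexp (- z) in
  nowhere_real_differentiable rho /\
  (forall n m : nat, universal n m (NN rho n m (n + m + 1))).
Proof.
move=> wc wb wn; split; first exact: perturbed_sin_nowhere.
by move=> n m; exact: perturbed_sin_universal.
Qed.
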